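(* Let $p(\cdot)\in\mathcal{P}$ with $p(\cdot)\in LH$ and $p_->1$. Then $\mathcal{A}_{p(\cdot),\infty}=\mathcal{A}^{\ast}_{p(\cdot),\infty}$.
   Context: Everything is on $\mathbb{R}^n$. $\mathcal{P}$ is the set of measurable $p:\mathbb{R}^n\to[1,\infty]$; $p_-:=\operatorname{ess\,inf}_{x\in\mathbb{R}^n}p(x)$. A measurable real-valued function $r$ on $\mathbb{R}^n$ belongs to $LH$ if there is $C_0>0$ with $|r(x)-r(y)|\le -\frac{C_0}{\log|x-y|}$ whenever $|x-y|<\frac12$, and there are positive constants $r_\infty,C_\infty$ with $|r(x)-r_\infty|\le\frac{C_\infty}{\log(e+|x|)}$ for all $x$. For a measurable function $f$, $\|f\|_{L^{p(\cdot)}}:=\inf\{\lambda>0:\int_{\mathbb{R}^n}|f(x)/\lambda|^{p(x)}\,dx\le1\}$ (with $\inf\emptyset=\infty$). Cubes have finite positive edge length and edges parallel to the axes (not necessarily open or closed); $\fint_Q$ denotes the average $\frac1{|Q|}\int_Q$. A scalar weight is a non-negative measurable function on $\mathbb{R}^n$ that is positive almost everywhere. $\mathcal{A}_{p(\cdot),\infty}$ is the set of scalar weights $w$ with $$[w]_{\mathcal{A}_{p(\cdot),\infty}}:=\sup_Q\frac{1}{\|\mathbf{1}_Q\|_{L^{p(\cdot)}}}\|w\mathbf{1}_Q\|_{L^{p(\cdot)}}\exp\left(\fint_Q\log(w^{-1}(y))\,dy\right)<\infty,$$ and $\mathcal{A}^{\ast}_{p(\cdot),\infty}$ is the set of scalar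 weights $w$ with $$[w]_{\mathcal{A}^{\ast}_{p(\cdot),\infty}}:=\sup_Q\frac{1}{\|\mathbf{1}_Q\|_{L^{p(\cdot)}}}\|w\mathbf{1}_Q\|_{L^{p(\cdot)}}\left[\fint_Q w(x)\,dx\right]^{-1}<\infty,$$ the suprema being over all cubes. In these suprema $\infty^{-1}=0$ and a product $\infty\cdot0$ is understood as $\infty$. *)

(* Defs.v *)
From HB Require Import structures.
From mathcomp Require Import all_boot all_order all_algebra.
From mathcomp Require Import all_classical all_reals all_analysis.
From mathcomp Require Import measurable_realfun ess_sup_inf.

Set Implicit Arguments.
Unset Strict Implicit.
Unset Printing Implicit Defensive.
Import Order.TTheory GRing.Theory Num.Theory.
Import numFieldNormedType.Exports.

Local Open Scope classical_set_scope.
Local Open Scope ring_scope.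

Section borel_lebesgue_measure.
Context {R : realType}.
Local Notation RB := (measurableTypeR R).

Definition tcons n (x : RB * n.-tuple RB) : n.+1.-tuple RB :=
  [the n.+1.-tuple RB of x.1 :: x.2].

Definition tuncons n (t : n.+1.-tuple RB) : RB * n.-tuple RB :=
  (tnth t ord0, [tuple of behead t]).

Lemma tconsK n : cancel (@tcons n) (@tuncons n).
Proof. by case=> a t; congr pair; exact/val_inj. Qed.

Lemma tunconsK n : cancel (@tuncons n) (@tcons n).
Proof. by move=> t; rewrite [RHS]tuple_eta; exact/val_inj. Qed.

Lemma measurable_tcons n : measurable_fun [set: RB * n.-tuple RB] (@tcons n).
Proof. exact: (measurable_cons measurable_fst measurable_snd). Qed.

Lemma measurable_tuncons n : measurable_fun [set: n.+1.-tuple RB] (@tuncons n).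
Proof.
apply/measurable_fun_pairP; split; first exact: (measurable_tnth ord0).
exact: measurable_behead.
Qed.

Section step.
Variables (n : nat) (mu : {sigma_finite_measure set (n.-tuple RB) -> \bar R}).

Definition borel_step : set (n.+1.-tuple RB) -> \bar R :=
  pushforward (@lebesgue_measure R \x mu)%E (@tcons n).

Let borel_step0 : borel_step set0 = 0%E.
Proof. by rewrite /borel_step /pushforward preimage_set0 measure0. Qed.

Let borel_step_ge0 A : (0 <= borel_step A)%E.
Proof. by rewrite /borel_step /pushforward measure_ge0. Qed.

Let borel_step_sigma_additive : semi_sigma_additive borel_step.
Proof.
move=> F mF tF mUF; rewrite /borel_step /pushforward preimage_bigcup.
apply: measure_semi_sigma_additive.
- by move=> k; rewrite -[X in measurable X]setTI; exact: measurable_tcons.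
- apply/trivIsetP => /= i j _ _ ij; rewrite -preimage_setI.
  by move/trivIsetP : tF => /(_ _ _ _ _ ij) ->//; rewrite preimage_set0.
- rewrite -preimage_bigcup -[X in measurable X]setTI.
  exact: measurable_tcons.
Qed.

HB.instance Definition _ := isMeasure.Build _ _ _ borel_step
  borel_step0 borel_step_ge0 borel_step_sigma_additive.

Lemma borel_stepX A B : measurable A -> measurable B ->
  borel_step (@tuncons n @^-1` (A `*` B)) = (lebesgue_measure A * mu B)%E.
Proof.
move=> mA mB; rewrite /borel_step /pushforward -comp_preimage.
rewrite (_ : _ \o _ = id); first by rewrite preimage_id product_measure1E.
by apply/funext => x /=; rewrite tconsK.
Qed.

Let borel_step_sigma_finite : sigma_finite setT borel_step.
Proof.
have /sigma_finiteP[F [TF ndF Foo]] := sigma_finiteT (@lebesgue_measure R).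
have /sigma_finiteP[G [TG ndG Goo]] := sigma_finiteT mu.
exists (fun k => @tuncons n @^-1` (F k `*` G k)).
  rewrite -preimage_bigcup (_ : \bigcup_k _ = setT) ?preimage_setT//.
  rewrite -setXTT TF TG predeqE => -[x y]; split.
    by move=> [k _ []/= ? ?]; split; exists k.
  move=> [/= [k _ Fkx] [l _ Gly]]; exists (maxn k l) => //; split.
  - by move: x Fkx; exact/subsetPset/ndF/leq_maxl.
  - by move: y Gly; exact/subsetPset/ndG/leq_maxr.
move=> k; have [mF Fk] := Foo k; have [mG Gk] := Goo k; split.
  rewrite -[X in measurable X]setTI.
  by apply: measurable_tuncons => //; exact: measurableX.
by rewrite borel_stepX// lte_mul_pinfty// ge0_fin_numE.
Qed.

HB.instance Definition _ := Measure_isSigmaFinite.Build _ _ _ borel_step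
  borel_step_sigma_finite.
End step.

(* The Borel-Lebesgue measure on R^n, by iterated product:
   mu_0 is the unit mass on the empty tuple, and mu_{n+1} is the image of
   [lebesgue_measure \x mu_n] under [(a, t) |-> a :: t]. *)
Fixpoint borel_lebesgue (n : nat) :
    {sigma_finite_measure set (n.-tuple RB) -> \bar R} :=
  match n with
  | 0 => \d_([tuple] : 0.-tuple RB)
  | k.+1 => borel_step (borel_lebesgue k)
  end.
End borel_lebesgue_measure.

Definition box (R : realType) n (I : 'I_n -> set (measurableTypeR R)) :
    set (n.-tuple (measurableTypeR R)) :=
  [set t | forall i, I i (tnth t i)].

Lemma box_recl (R : realType) n (I : 'I_n.+1 -> set (measurableTypeR R)) :
  box I = @tuncons R n @^-1` (I ord0 `*` box (fun i => I (lift ord0 i))).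
Proof.
apply/seteqP; split=> t /=.
  move=> It; split=> [|i]; first exact: It.
  have := It (lift ord0 i).
  by rewrite (tuple_eta t) tnthS; congr (I _ _); congr tnth; exact/val_inj.
move=> [I0 Is] i; have [j ->|->//] := unliftP ord0 i.
have := Is j.
rewrite [in X in _ -> X](tuple_eta t) tnthS.
by congr (I _ _); congr tnth; exact/val_inj.
Qed.

Lemma measurable_box (R : realType) n (I : 'I_n -> set (measurableTypeR R)) :
  (forall i, measurable (I i)) -> measurable (box I).
Proof.
elim: n I => [|n IHn] I mI.
  rewrite (_ : box I = setT); first exact: measurableT.
  by apply/seteqP; split=> // t _ [].
rewrite box_recl -[X in measurable X]setTI; apply: measurable_tuncons => //.
by apply: measurableX => //; apply: IHn.
Qed.

Lemma borel_lebesgue_box (R : realType) n (I : 'I_n -> set (measurableTypeR R)) :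
  (forall i, measurable (I i)) ->
  borel_lebesgue n (box I) = (\prod_(i < n) lebesgue_measure (I i))%E.
Proof.
elim: n I => [|n IHn] I mI.
  rewrite big_ord0 /= diracE mem_set// => -[//].
rewrite box_recl big_ord_recl -IHn// /= borel_stepX//.
exact: measurable_box.
Qed.

(* R^n with the sigma-algebra of its Lebesgue measurable sets (the Caratheodory
   sets of the outer measure induced by [borel_lebesgue]), and the (complete)
   Lebesgue measure on it; same construction as the library's
   [completed_lebesgue_measure]. *)
Definition Rn (R : realType) (n : nat) : Type :=
  caratheodory_type ((@borel_lebesgue R n)^*)%mu.

HB.instance Definition _ (R : realType) (n : nat) := Measurable.on (Rn R n).

Definition lebesgueRn (R : realType) (n : nat) : set (Rn R n) -> \bar R :=
  @completed_measure_extension _ _ R (borel_lebesgue n).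

HB.instance Definition _ (R : realType) (n : nat) :=
  Measure.on (@lebesgueRn R n).

Definition rn_coord (R : realType) (n : nat) (x : Rn R n) (i : 'I_n) : R :=
  tnth (x : n.-tuple (measurableTypeR R)) i.

Lemma lebesgueRn_cube (R : realType) n (a : 'I_n -> R) (l : R) bl br : 0 < l ->
  @lebesgueRn R n [set x : Rn R n | forall i, rn_coord x i \in
     Interval (BSide (bl i) (a i)) (BSide (br i) (a i + l))] = (l ^+ n)%:E.
Proof.
move=> l0; pose I i : set (measurableTypeR R) :=
  [set` Interval (BSide (bl i) (a i)) (BSide (br i) (a i + l))].
have mI i : measurable (I i) by exact: measurable_itv.
rewrite /lebesgueRn /completed_measure_extension.
rewrite (_ : [set _ | _] = box I)//.
rewrite measurable_mu_extE; last exact: measurable_box.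
rewrite [LHS](borel_lebesgue_box mI).
under eq_bigr do
  rewrite lebesgue_measure_itv /= lte_fin ltrDl l0 -EFinD addrAC subrr add0r.
by rewrite prodEFin prodr_const card_ord.
Qed.

Section variable_exponent_weights.
Context {R : realType} {n : nat}.
Local Notation V := (Rn R n).
Local Notation mu := (@lebesgueRn R n).

Definition enorm (x : V) : R := Num.sqrt (\sum_(i < n) rn_coord x i ^+ 2).

Definition edist (x y : V) : R :=
  Num.sqrt (\sum_(i < n) (rn_coord x i - rn_coord y i) ^+ 2).

(* Each edge may independently contain or omit either of its endpoints. *)
Definition cube : set (set V) :=
  [set Q : set V | exists (a : 'I_n -> R) (l : R) (bl br : 'I_n -> bool),
     0 < l /\
     Q = [set x | forall i,
       rn_coord x i \in Interval (BSide (bl i) (a i)) (BSide (br i) (a i + l))]].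

(* The class P of exponents with values in [1, +oo]. *)
Definition var_exponent : set (V -> \bar R) :=
  [set p : V -> \bar R | measurable_fun setT p /\ forall x, (1 <= p x)%E].

(* At x = y the convention -C0 / log 0 = 0 agrees with [ln 0 = 0], [/ 0 = 0]. *)
Definition local_LH (r : V -> R) : Prop :=
  exists2 C0 : R, 0 < C0 &
    forall x y, edist x y < 1 / 2 -> `|r x - r y| <= - (C0 / ln (edist x y)).

Definition decay_LH (r : V -> R) : Prop :=
  exists r_oo C_oo : R, [/\ 0 < r_oo, 0 < C_oo &
    forall x, `|r x - r_oo| <= C_oo / ln (expR 1 + enorm x)].

Definition LH : set (V -> R) :=
  [set r : V -> R | [/\ measurable_fun setT r, local_LH r & decay_LH r]].

(* Functions in LH are real-valued, so an exponent in LH is finite everywhere. *)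
Definition var_exponent_LH (p : V -> \bar R) : Prop :=
  exists2 r : V -> R, LH r & p = EFin \o r.

(* t ^ q for t >= 0 and q in [1, +oo]; t ^ +oo is 0 for t <= 1 and +oo for
   t > 1. *)
Definition vpow (t : R) (q : \bar R) : \bar R :=
  match q with
  | r%:E => (t `^ r)%:E
  | +oo%E => if t <= 1 then 0%E else +oo%E
  | -oo%E => 0%E
  end.

Definition modular (p : V -> \bar R) (f : V -> R) : \bar R :=
  (\int[mu]_x vpow `|f x|%R (p x))%E.

Definition vLnorm (p : V -> \bar R) (f : V -> R) : \bar R :=
  ereal_inf [set l%:E | l in
    [set l : R | 0 < l /\ (modular p (fun x => f x / l)%R <= 1)%E]].

Definition average (Q : set V) (f : V -> \bar R) : \bar R :=
  ((mu Q)^-1 * \int[mu]_(x in Q) f x)%E.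

(* Product on [0, +oo] with +oo * 0 = 0 * +oo = +oo (in [mule] these are 0). *)
Definition mulI (x y : \bar R) : \bar R :=
  if (x == +oo%E) || (y == +oo%E) then +oo%E else (x * y)%E.

Definition scalar_weight : set (V -> R) :=
  [set w : V -> R | [/\ measurable_fun setT w, forall x, 0 <= w x &
     {ae mu, forall x, 0 < w x}]].

(* [(w y)%:E^-1] is +oo where w y = 0.  The average of log(w^-1) over Q is
   undefined only if w is not integrable on Q; the integral of the library is
   then -oo, so that the exponential is 0. For bounded p the norm of w 1_Q is
   +oo in that case, and so is the product, whatever value the average gets. *)
Definition Ap_oo_const (p : V -> \bar R) (w : V -> R) : \bar R :=
  ereal_sup [set
    mulI (mulI (vLnorm p \1_Q)^-1 (vLnorm p (fun x => w x * \1_Q x)%R))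
         (expeR (average Q (fun y => lne (w y)%:E^-1)))
  | Q in cube]%E.

Definition Ap_oo_star_const (p : V -> \bar R) (w : V -> R) : \bar R :=
  ereal_sup [set
    mulI (mulI (vLnorm p \1_Q)^-1 (vLnorm p (fun x => w x * \1_Q x)%R))
         (average Q (fun x => (w x)%:E))^-1
  | Q in cube]%E.

Definition Ap_oo (p : V -> \bar R) : set (V -> R) :=
  [set w : V -> R | scalar_weight w /\ (Ap_oo_const p w < +oo)%E].

Definition Ap_oo_star (p : V -> \bar R) : set (V -> R) :=
  [set w : V -> R | scalar_weight w /\ (Ap_oo_star_const p w < +oo)%E].

End variable_exponent_weights.

(* Main.v *)
Require Import Defs.
From mathcomp Require Import all_boot all_order all_algebra.
From mathcomp Require Import all_classical all_reals all_analysis.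
From mathcomp Require Import measurable_realfun ess_sup_inf.
From mathcomp Require Import ring lra.

Set Implicit Arguments.
Unset Strict Implicit.
Unset Printing Implicit Defensive.
Import Order.TTheory GRing.Theory Num.Theory.
Import numFieldNormedType.Exports.

(** Both conditions involve, for each cube [Q], the same factor
    [a_Q = ||w 1_Q|| / ||1_Q||]; it is multiplied by the exponential of the mean of
    [log w^-1] in the first one and by the inverse of the mean of [w] in the second
    one. By Jensen's inequality ([weight_average_le]) the second product is at most
    the first one. For the converse inclusion, let [a_Q] be at most [K] times the
    mean [w_Q] of [w] on [Q], for each [Q]; it then suffices to bound [w_Q] times the
    exponential of the mean of [log w^-1].

    The bound on [a_Q] is a kind of reverse Hoelder inequality, because the
    exponent is at least some [s > 1]: a function of norm 1 is essentially bounded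
    by [M / ||1_Q||], up to a part whose integral is small for large [M]. Hence a
    subset of [Q] with a small portion of its volume carries at most half of the
    mass of [w] on [Q] ([star_small_half]). The norm of [1_Q] has to be compared
    with powers of the volume of [Q], and this is where log-Hoelder continuity
    enters ([norm_cube]): for small cubes the exponent is nearly constant on [Q];
    for large ones it can be replaced by its limit at infinity, up to an integrable
    error.

    The rest is the theory of Muckenhoupt weights for the Lebesgue measure. The
    property just obtained yields doubling ([doubling]), and a stopping-time argument
    on dyadic subcubes then shows that the portion of [Q] where [w] is less than
    [theta ^+ k * w_Q] is at most [(1 - alpha) ^+ k] ([level_set_decay]). Summing over
    [k] bounds the mean of [log (w_Q / w)] ([log_inv_mean]).

    Instead of differentiating integrals, the stopping argument uses that each
    measurable set is close in measure to a finite union of dyadic cubes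
    ([approximable_measurable]). Everything is proved on half-open cubes; any cube
    coincides with one of them up to a null set ([cube_ae_hcube]). *)

(** * Half-open cubes and the mass of a function on a set *)

Section cubes.
Local Open Scope classical_set_scope.
Local Open Scope ring_scope.
Context {R : realType} {n : nat}.
Local Notation V := (Rn R n).
Local Notation mu := (@lebesgueRn R n).

Implicit Types (a : 'I_n -> R) (l : R) (A B : set V) (w : V -> R).

Lemma measurable_Rn_borel (A : set (n.-tuple (measurableTypeR R))) :
  measurable A -> measurable (A : set V).
Proof. exact: caratheodory_measurable_mu_ext. Qed.

Lemma lebesgueRn_borel (A : set (n.-tuple (measurableTypeR R))) :
  measurable A -> mu A = borel_lebesgue n A.
Proof. exact: measurable_mu_extE. Qed.

Lemma measurable_rn_coord (i : 'I_n) :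
  measurable_fun setT (fun x : V => rn_coord x i : measurableTypeR R).
Proof.
move=> _ B mB; rewrite setTI.
apply: measurable_Rn_borel.
have := @measurable_tnth _ (measurableTypeR R) n i measurableT B mB.
by rewrite setTI.
Qed.

(** Half-open cubes: unlike the other ones, they are disjoint unions of dyadic
    subcubes of the same kind. *)
Definition hcube (a : 'I_n -> R) (l : R) : set V :=
  [set x | forall i, a i <= rn_coord x i < a i + l].

Lemma hcube_box (a : 'I_n -> R) l :
  hcube a l = box (fun i => `[a i, a i + l[%classic).
Proof.
by apply/seteqP; split=> x /= h i; have := h i; rewrite /= in_itv.
Qed.

Lemma measurable_hcube a l : measurable (hcube a l).
Proof.
rewrite hcube_box; apply: measurable_Rn_borel; apply: measurable_box => i.
exact: measurable_itv.
Qed.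

Lemma hcube_itv (a : 'I_n -> R) l : hcube a l = [set x : V | forall i,
  rn_coord x i \in Interval (BSide true (a i)) (BSide true (a i + l))].
Proof.
by apply/seteqP; split=> x /= h i; have := h i; rewrite in_itv.
Qed.

Lemma cube_hcube a l : 0 < l -> cube (hcube a l).
Proof.
move=> l0; exists a, l, (fun=> true), (fun=> true); split=> //; exact: hcube_itv.
Qed.

Lemma lebesgue_hcube a l : 0 < l -> mu (hcube a l) = (l ^+ n)%:E.
Proof.
by move=> l0; rewrite hcube_itv (@lebesgueRn_cube R n a l (fun=> true) (fun=> true)).
Qed.

(** A real number, so that comparisons of masses are comparisons of reals; it is
    the actual integral as soon as the set lies in a cube, see [mass_fin_sub]. *)
Definition mass (w : V -> R) (A : set V) : R := fine (\int[mu]_(x in A) (w x)%:E).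

(** The volume is a mass as well, so that each lemma on masses applies to it. *)
Definition vol : set V -> R := mass (cst 1).

Lemma volE A : measurable A -> vol A = fine (mu A).
Proof. by move=> mA; rewrite /vol /mass (eq_integral (cst 1%E))// integral_cst// mul1e. Qed.

Lemma vol_hcube a l : 0 < l -> vol (hcube a l) = l ^+ n.
Proof.
by move=> l0; rewrite volE ?lebesgue_hcube//; exact: measurable_hcube.
Qed.

Definition loc_weight (w : V -> R) : Prop :=
  [/\ measurable_fun setT w, forall x, 0 <= w x &
   forall a l, 0 < l -> (\int[mu]_(x in hcube a l) (w x)%:E < +oo)%E].

Lemma loc_weight1 : loc_weight (cst 1).
Proof.
split=> // a l l0; rewrite (eq_integral (cst 1%E))// integral_cst.
  by rewrite mul1e -[X in (X < _)%E]/(mu _) lebesgue_hcube// ltry.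
exact: measurable_hcube.
Qed.

Section mass.
Variables (w : V -> R) (ww : loc_weight w).

Let mw (D : set V) : measurable_fun D (EFin \o w).
Proof.
by apply/measurable_EFinP; case: ww => h _ _; exact: measurable_funS h.
Qed.

Let w0 (x : V) : (0 <= (w x)%:E)%E.
Proof. by case: ww => _ h _; rewrite lee_fin. Qed.

Lemma mass_ge0 A : 0 <= mass w A.
Proof. by apply: fine_ge0; apply: integral_ge0. Qed.

Lemma mass_fin a l A : 0 < l -> measurable A ->
  (\int[mu]_(x in hcube a l `&` A) (w x)%:E)%E = (mass w (hcube a l `&` A))%:E.
Proof.
move=> l0 mA; rewrite /mass fineK// ge0_fin_numE; last exact: integral_ge0.
case: ww => _ _ /(_ a l l0); apply: le_lt_trans.
apply: ge0_subset_integral => //.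
- by apply: measurableI => //; exact: measurable_hcube.
- exact: measurable_hcube.
Qed.

Lemma mass_fin_sub a l A : 0 < l -> measurable A -> A `<=` hcube a l ->
  (\int[mu]_(x in A) (w x)%:E)%E = (mass w A)%:E.
Proof. by move=> l0 mA /setIidPr <-; exact: mass_fin. Qed.

Lemma le_mass a l A B : 0 < l -> measurable A -> measurable B ->
  A `<=` B -> B `<=` hcube a l -> mass w A <= mass w B.
Proof.
move=> l0 mA mB AB BQ; have AQ := subset_trans AB BQ.
rewrite -lee_fin -(mass_fin_sub l0 mA AQ) -(mass_fin_sub l0 mB BQ).
exact: ge0_subset_integral.
Qed.

Lemma massID a l A B : 0 < l -> measurable A -> measurable B ->
  A `<=` hcube a l -> mass w A = mass w (A `&` B) + mass w (A `\` B).
Proof.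
move=> l0 mA mB AQ; apply: EFin_inj.
have mI := measurableI A B mA mB; have mD := measurableD mA mB.
have IQ : A `&` B `<=` hcube a l by move=> x [/AQ].
have DQ : A `\` B `<=` hcube a l by move=> x [/AQ].
rewrite EFinD -(mass_fin_sub l0 mA AQ) -(mass_fin_sub l0 mI IQ).
rewrite -(mass_fin_sub l0 mD DQ).
rewrite -{1}(setUIDK A B) ge0_integral_setU ?setUIDK//.
by apply/disj_set2P; rewrite -subset0 => x [[_ Bx] [_ ]].
Qed.

End mass.
End cubes.

(** * Dyadic subcubes *)

Section dyadic.
Local Open Scope classical_set_scope.
Local Open Scope ring_scope.
Context {R : realType} {n : nat}.
Local Notation V := (Rn R n).
Local Notation mu := (@lebesgueRn R n).
Implicit Types (a : 'I_n -> R) (l : R) (A B D E : set V) (w : V -> R).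

Definition child a l (b : {ffun 'I_n -> bool}) (i : 'I_n) : R :=
  a i + (if b i then l / 2 else 0).

Lemma subset_child a l b : 0 < l -> hcube (child a l b) (l / 2) `<=` hcube a l.
Proof.
move=> l0 x h i; have := h i; rewrite /child.
by case: (b i) => /andP[h1 h2]; apply/andP; split; lra.
Qed.

Lemma child_cover a l x : hcube a l x ->
  exists b, hcube (child a l b) (l / 2) x.
Proof.
move=> h; exists [ffun i => a i + l / 2 <= rn_coord x i] => i.
have := h i; rewrite /child ffunE; case: (leP (a i + l / 2)) => /= ? /andP[h1 h2].
  by apply/andP; split; lra.
by apply/andP; split; lra.
Qed.

Lemma child_inj a l b b' x : hcube (child a l b) (l / 2) x ->
  hcube (child a l b') (l / 2) x -> b = b'.
Proof.
move=> h h'; apply/ffunP => i; have := h i; have := h' i; rewrite /child.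
by case: (b i); case: (b' i) => // /andP[h1 h2] /andP[h3 h4]; exfalso; lra.
Qed.

Lemma mass_children w a l A : loc_weight w -> 0 < l -> measurable A ->
  mass w (hcube a l `&` A) =
  \sum_(b : {ffun 'I_n -> bool}) mass w (hcube (child a l b) (l / 2) `&` A).
Proof.
move=> ww l0 mA; apply: EFin_inj; rewrite -mass_fin//.
have l20 : 0 < l / 2 by lra.
rewrite -sumEFin.
under eq_bigr do rewrite -mass_fin//.
pose F b := hcube (child a l b) (l / 2) `&` A.
have mF b : measurable (F b).
  by apply: measurableI => //; exact: measurable_hcube.
have tF : trivIset [set` index_enum {ffun 'I_n -> bool}] F.
  apply/trivIsetP => b b' _ _ /eqP bb'; rewrite -subset0 => x [[h _] [h' _]].
  exact/bb'/(child_inj h h').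
have [mw w0 _] := ww.
have mwU : measurable_fun (\big[setU/set0]_b F b) (EFin \o w).
  by apply/measurable_EFinP; exact: measurable_funTS mw.
have w0U x : (\big[setU/set0]_b F b) x -> (0 <= (w x)%:E)%E by rewrite lee_fin.
rewrite -(ge0_integral_bigsetU mu mF (index_enum_uniq _) tF mwU w0U).
congr (integral _ _ _); rewrite -bigcup_seq; apply/seteqP; split=> x.
  move=> [Qx Ax]; have [b bx] := child_cover Qx.
  by exists b => //=; rewrite mem_index_enum.
by move=> [b _ [bx Ax]]; split=> //; exact: subset_child bx.
Qed.

(** [D] is, inside the cube, a union of dyadic subcubes of generation [N]. The
    recursive form follows the recursion of the stopping argument. *)
Fixpoint adapted (N : nat) a l D : Prop :=
  match N with
  | 0 => hcube a l `<=` D \/ hcube a l `<=` ~` D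
  | N'.+1 => forall b, adapted N' (child a l b) (l / 2) D
  end.

Lemma adaptedS N a l D : 0 < l -> adapted N a l D -> adapted N.+1 a l D.
Proof.
elim: N a l => [|N IH] a l l0 /= h b; last first.
  by apply: IH; [lra|exact: h].
by case: h => h; [left|right]; exact: subset_trans (subset_child l0) h.
Qed.

Lemma adapted_le N M a l D : (N <= M)%N -> 0 < l ->
  adapted N a l D -> adapted M a l D.
Proof.
move=> /subnK <- l0 h; elim: (M - N)%N => // k; rewrite addSn; exact: adaptedS.
Qed.

Lemma adaptedC N a l D : adapted N a l D -> adapted N a l (~` D).
Proof.
elim: N a l => [|N IH] a l /= h; last by move=> b; exact/IH/h.
by rewrite setCK; case: h => h; [right|left].
Qed.

Lemma adaptedU N a l D E : adapted N a l D -> adapted N a l E ->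
  adapted N a l (D `|` E).
Proof.
elim: N a l => [|N IH] a l /= h h'; last by move=> b; exact: IH.
case: h => h; first by left; exact: subset_trans h (@subsetUl _ _ _).
case: h' => h'; first by left; exact: subset_trans h' (@subsetUr _ _ _).
by right; rewrite setCU => x Qx; split; [exact: h|exact: h'].
Qed.

(** Half-spaces bounded by a hyperplane of the dyadic grid are the building
    blocks of the approximation: half-spaces generate the Borel sets. *)
Lemma adapted_halfspace N a l i (k : int) : 0 < l ->
  adapted N a l [set x : V | rn_coord x i < a i + l * k%:~R / 2 ^+ N].
Proof.
elim: N a l k => [|N IH] a l k l0 /=.
  rewrite expr0 divr1; have [k0|k1] := leP k 0.
    right=> x /(_ i)/andP[h _] /=; apply/negP; rewrite -leNgt.
    by apply: le_trans h; rewrite gerDl mulr_ge0_le0// ?lerz0// ltW.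
  left=> x /(_ i)/andP[_ h] /=; apply: (lt_le_trans h).
  by rewrite lerD2l ler_peMr ?(ltW l0)// ler1z.
move=> b; have l20 : 0 < l / 2 by lra.
have := IH (child a l b) (l / 2) (k - (if b i then 2 ^+ N else 0)) l20.
congr adapted; congr mkset; apply/funext => x; congr (_ < _).
rewrite /child exprS; have : (2 : R) ^+ N != 0 by rewrite expf_neq0.
case: (b i) => h.
  by rewrite intrB rmorphXn/=; field.
by rewrite subr0; field.
Qed.

End dyadic.

(** * Approximation of measurable sets by dyadic sets *)

Section approximation.
Local Open Scope classical_set_scope.
Local Open Scope ring_scope.
Context {R : realType} {n : nat}.
Local Notation V := (Rn R n).
Local Notation mu := (@lebesgueRn R n).
Implicit Types (a : 'I_n -> R) (l : R) (A B D E : set V) (w : V -> R).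

Lemma lebesgue_vol a l A : 0 < l -> measurable A ->
  mu (hcube a l `&` A) = (vol (hcube a l `&` A))%:E.
Proof.
move=> l0 mA; rewrite -(mass_fin loc_weight1)// (eq_integral (cst 1%E))//.
rewrite integral_cst ?mul1e//; apply: measurableI => //.
exact: measurable_hcube.
Qed.

Lemma vol_ge0 A : 0 <= vol A.
Proof. exact: mass_ge0 loc_weight1 _. Qed.

Lemma le_volI a l A B : 0 < l -> measurable A -> measurable B ->
  hcube a l `&` A `<=` B -> vol (hcube a l `&` A) <= vol (hcube a l `&` B).
Proof.
move=> l0 mA mB AB; apply: (le_mass loc_weight1 l0).
- by apply: measurableI => //; exact: measurable_hcube.
- by apply: measurableI => //; exact: measurable_hcube.
- by move=> x [Qx Ax]; split=> //; exact: AB.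
- exact: subIsetl.
Qed.

Lemma vol_setU_le a l A B : 0 < l -> measurable A -> measurable B ->
  vol (hcube a l `&` (A `|` B)) <= vol (hcube a l `&` A) + vol (hcube a l `&` B).
Proof.
move=> l0 mA mB; have mQ := measurable_hcube a l.
have mU := measurableU A B mA mB.
rewrite /vol (massID loc_weight1 l0 (measurableI _ _ mQ mU) mA (@subIsetl _ _ _)).
apply: lerD.
  apply: (le_mass loc_weight1 l0) => //.
  - by apply: measurableI => //; exact: measurableI.
  - exact: measurableI.
  - by move=> x [[Qx _] Ax].
rewrite (_ : _ `\` _ = hcube a l `&` (B `\` A)).
  by apply: le_volI => //; [exact: measurableD|move=> x [_ []]].
by apply/seteqP; split=> x; [move=> [[Qx [?|?]] ?]//|move=> [Qx [? ?]]; split => //; split=> //; right].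
Qed.

Definition symd D E : set V := (D `\` E) `|` (E `\` D).

Lemma measurable_symd D E : measurable D -> measurable E -> measurable (symd D E).
Proof. by move=> mD mE; apply: measurableU; exact: measurableD. Qed.

(** Approximation in measure by dyadic sets. Combined with the lower bound on the
    part of each unstopped cube outside a set, it does here the work of the
    Lebesgue differentiation theorem. *)
Definition approximable a l E : Prop := measurable E /\
  forall e : R, 0 < e -> exists N D, [/\ measurable D, adapted N a l D &
    vol (hcube a l `&` symd D E) < e].

Lemma approximableC a l E : approximable a l E -> approximable a l (~` E).
Proof.
move=> [mE h]; split; first exact: measurableC.
move=> e /h[N [D [mD aD De]]]; exists N, (~` D); split.
- exact: measurableC.
- exact: adaptedC.
- rewrite (_ : symd _ _ = symd D E)//; apply/seteqP; split=> x.
    by move=> [[/= Dx /contrapT Ex]|[Ex /= /contrapT Dx]]; [right|left].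
  by move=> [[Dx Ex]|[Ex Dx]]; [right|left]; split=> //=; rewrite notK.
Qed.

Lemma approximableU a l E F : 0 < l -> approximable a l E -> approximable a l F ->
  approximable a l (E `|` F).
Proof.
move=> l0 [mE hE] [mF hF]; split; first exact: measurableU.
move=> e e0; have e20 : 0 < e / 2 by lra.
have [N [D [mD aD De]]] := hE _ e20.
have [M [D' [mD' aD' De']]] := hF _ e20.
exists (maxn N M), (D `|` D'); split.
- exact: measurableU.
- apply: adaptedU.
    by apply: adapted_le aD => //; exact: leq_maxl.
  by apply: adapted_le aD' => //; exact: leq_maxr.
- have m1 := measurable_symd mD mE; have m2 := measurable_symd mD' mF.
  have : vol (hcube a l `&` symd (D `|` D') (E `|` F)) <=
    vol (hcube a l `&` (symd D E `|` symd D' F)).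
    apply: le_volI => //.
    + by apply: measurable_symd; exact: measurableU.
    + exact: measurableU.
    + move=> x [Qx [[[Dx|Dx]]|[[Dx|Dx]]]] /not_orP[h1 h2].
      * by left; left.
      * by right; left.
      * by left; right.
      * by right; right.
  move=> h; apply: (le_lt_trans h); apply: (le_lt_trans (vol_setU_le a l0 m1 m2)).
  lra.
Qed.

Lemma approximable_close a l E : 0 < l -> measurable E ->
  (forall e : R, 0 < e -> exists F, approximable a l F /\
     vol (hcube a l `&` symd F E) < e) -> approximable a l E.
Proof.
move=> l0 mE h; split=> // e e0; have e20 : 0 < e / 2 by lra.
have [F [[mF /(_ _ e20)[N [D [mD aD De]]]] FE]] := h _ e20.
exists N, D; split=> //.
have m1 := measurable_symd mD mF; have m2 := measurable_symd mF mE.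
have k : vol (hcube a l `&` symd D E) <= vol (hcube a l `&` (symd D F `|` symd F E)).
  apply: le_volI => //; first exact: measurable_symd.
    exact: measurableU.
  move=> x [Qx [[Dx Ex]|[Ex Dx]]]; have [Fx|Fx] := pselect (F x).
  + by right; left.
  + by left; left.
  + by left; right.
  + by right; right.
apply: (le_lt_trans k); apply: (le_lt_trans (vol_setU_le a l0 m1 m2)); lra.
Qed.

(** By continuity of the measure a finite union is already close to the whole
    union; with [approximableC] this makes the approximable sets a
    sigma-algebra. *)
Lemma approximable_bigcup a l (F : (set V)^nat) : 0 < l ->
  (forall k, approximable a l (F k)) -> approximable a l (\bigcup_k F k).
Proof.
move=> l0 hF.
have mF k : measurable (F k) by have [] := hF k.
have mU : measurable (\bigcup_k F k) by exact: bigcupT_measurable.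
apply: approximable_close => // e e0.
pose G k := \big[setU/set0]_(i < k) F i.
have mG k : measurable (G k) by apply: bigsetU_measurable.
have GF k : G k `<=` \bigcup_k F k by exact: bigsetU_bigcup.
have mQ := measurable_hcube a l.
have cv : (fun k => mu (hcube a l `&` G k)) @ \oo --> mu (hcube a l `&` \bigcup_k F k).
  rewrite (_ : \bigcup_k F k = \bigcup_k G k); last first.
    apply/seteqP; split=> x [k _ xk]; last exact: GF xk.
    by exists k.+1 => //; rewrite /G big_ord_recr; right.
  rewrite setI_bigcupr.
  apply: (@nondecreasing_cvg_mu _ _ _ mu (fun k => hcube a l `&` G k)).
  - by move=> i; apply: measurableI.
  - by apply: bigcupT_measurable => i; apply: measurableI.
  - by move=> i j ij; apply/subsetPset; apply: setIS; exact: subset_bigsetU.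
have apG k : approximable a l (G k).
  rewrite /G; elim: k => [|k IH].
    rewrite big_ord0; split=> // d d0; exists 0%N, set0; split => //.
      by right=> x _; rewrite setC0.
    by rewrite /symd setD0 setU0 setI0 /vol /mass integral_set0.
  by rewrite big_ord_recr; exact: approximableU.
move: cv; rewrite lebesgue_vol//.
under eq_fun do rewrite lebesgue_vol//.
move=> /fine_cvgP[_] /cvgr_dist_lt /(_ _ e0)[k _ /(_ k (leqnn _))] /= h.
exists (G k); split; first exact: apG.
apply: le_lt_trans h.
have := massID loc_weight1 l0 (measurableI _ _ mQ mU) (mG k) (@subIsetl _ _ _).
rewrite -/vol -setIA (setIidr (@GF k)) => ->.
rewrite addrC addKr ger0_norm; last exact: vol_ge0.
rewrite -setIDA; apply: le_volI => //.
- exact: measurable_symd.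
- exact: measurableD.
- by move=> x [_ [[/GF]|]].
Qed.

End approximation.

Section approximation_all.
Local Open Scope classical_set_scope.
Local Open Scope ring_scope.
Context {R : realType} {n : nat}.
Local Notation V := (Rn R n).
Local Notation mu := (@lebesgueRn R n).
Implicit Types (a : 'I_n -> R) (l : R) (A B D E : set V) (w : V -> R).

Lemma lebesgue_slab (a : 'I_n -> R) l i (s d : R) : 0 < l -> 0 < d ->
  mu (box (fun j => if j == i then `[s, s + d[%classic else `[a j, a j + l[%classic)) =
  (d * l ^+ n.-1)%:E.
Proof.
move=> l0 d0; have mI j : measurable (if j == i then `[s, s + d[%classic
    else `[a j, a j + l[%classic : set (measurableTypeR R)).
  by case: ifP => _; exact: measurable_itv.
rewrite lebesgueRn_borel; last exact: measurable_box.
rewrite (borel_lebesgue_box mI) (bigD1 i)//= eqxx lebesgue_measure_itv /= lte_fin.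
rewrite ltrDl d0 -EFinD addrAC subrr add0r EFinM; congr (_ * _)%E.
rewrite (eq_bigr (fun=> l%:E)) => [|j /negbTE ->].
  by rewrite prodEFin prodr_const cardC1 card_ord.
by rewrite lebesgue_measure_itv /= lte_fin ltrDl l0 -EFinD addrAC subrr add0r.
Qed.

Lemma measurable_halfspace i (t : R) : measurable [set x : V | rn_coord x i < t].
Proof.
have := @measurable_rn_coord R n i measurableT `]-oo, t[%classic (measurable_itv _).
rewrite setTI; congr measurable; apply/seteqP; split=> x /=; by rewrite in_itv.
Qed.

Lemma exists_exp2_small (c e : R) : 0 < e -> exists N, c / 2 ^+ N < e.
Proof.
move=> e0; have [k ck] : exists k : nat, `|c| / e < k%:R.
  by exists (Num.truncn (`|c| / e)).+1; exact: truncnS_gt.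
exists k; rewrite ltr_pdivrMr ?exprn_gt0// mulrC -ltr_pdivrMr//.
have k2 : (k%:R : R) <= 2 ^+ k by rewrite -natrX ler_nat ltnW// ltn_expl.
apply: lt_le_trans k2; apply: le_lt_trans ck.
by rewrite ler_pM2r ?invr_gt0// ler_norm.
Qed.

(** Rounding [t] down to the dyadic grid changes the half-space by a slab of
    width [l / 2 ^+ N] at most. *)
Lemma approximable_halfspace a l i (t : R) : 0 < l ->
  approximable a l [set x : V | rn_coord x i < t].
Proof.
move=> l0; split; first exact: measurable_halfspace.
move=> e e0; have [N Ne] := exists_exp2_small (l ^+ n) e0.
pose d := l / 2 ^+ N.
have d0 : 0 < d by rewrite divr_gt0// exprn_gt0.
pose k := Num.floor ((t - a i) / d); pose s := a i + l * k%:~R / 2 ^+ N.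
have sE : s = a i + k%:~R * d by rewrite /s /d; ring.
have st : s <= t.
  have : k%:~R <= (t - a i) / d by exact: floor_le_tmp.
  by rewrite sE ler_pdivlMr// => ?; lra.
have ts : t < s + d.
  have : (t - a i) / d < (k + 1)%:~R by exact: floorD1_gt.
  by rewrite sE ltr_pdivrMr// intrD mulrDl mul1r => ?; lra.
exists N, [set x | rn_coord x i < s]; split.
- exact: measurable_halfspace.
- exact: adapted_halfspace.
- apply: le_lt_trans Ne; rewrite -lee_fin -lebesgue_vol//; last first.
    by apply: measurable_symd; exact: measurable_halfspace.
  have -> : ((l ^+ n / 2 ^+ N)%:E = (d * l ^+ n.-1)%:E)%E.
    have n0 : (0 < n)%N := leq_ltn_trans (leq0n _) (ltn_ord i).
    by congr EFin; rewrite /d -{1}(prednK n0) exprS; ring.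
  rewrite -(lebesgue_slab a i s l0 d0).
  apply: le_measure; rewrite ?inE.
  + apply: measurableI; first exact: measurable_hcube.
    by apply: measurable_symd; exact: measurable_halfspace.
  + apply: measurable_Rn_borel; apply: measurable_box => j.
    by case: ifP => _; exact: measurable_itv.
  + move=> x [Qx [[/= xs]|[/= xt]]] /negP; rewrite -leNgt.
      by move=> tx; exfalso; lra.
    move=> sx j; case: eqP => [->|_] /=; rewrite in_itv/=.
      by apply/andP; split; [exact: sx|exact: lt_trans xt ts].
    exact: Qx.
Qed.

Lemma approximable_borel a l (E : set (n.-tuple (measurableTypeR R))) : 0 < l ->
  measurable E -> approximable a l (E : set V).
Proof.
move=> l0; rewrite /measurable/= /g_sigma_preimage; move: E.
have sa (S : set (set V)) : S `<=` approximable a l -> <<s S >> `<=` approximable a l.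
  move=> h; apply: smallest_sub => //; split.
  - split; first exact: measurable0.
    move=> e e0; exists 0%N, set0; split=> //.
      by right=> x _; rewrite setC0.
    by rewrite /symd setD0 setU0 setI0 /vol /mass integral_set0.
  - by move=> A hA; rewrite setTD; exact: approximableC.
  - by move=> F hF; exact: approximable_bigcup.
apply: sa => E.
rewrite -bigcup_seq => -[i _ [B mB <-]]; rewrite setTI.
have {}mB : (@ocitv R).-sigma.-measurable B := mB.
rewrite RGenInftyO.measurableE in mB.
suff : [set B : set R | approximable a l
    [set x : V | B (rn_coord x i)]] B by [].
move: B mB; apply: smallest_sub.
  split=> /=.
  - have := approximableC (approximableU l0 (approximable_halfspace a i 0 l0)
      (approximableC (approximable_halfspace a i 0 l0))).
    by rewrite setUv setCT.
  - move=> B hB; apply: (eq_ind _ (approximable a l) (approximableC hB)).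
    by apply/seteqP; split=> x /= => [?|[]].
  - by move=> F hF; exact: (approximable_bigcup l0 hF).
move=> _ [t ->] /=.
rewrite (_ : mkset _ = [set x : V | rn_coord x i < t]); first exact: approximable_halfspace.
by apply/seteqP; split=> x /=; rewrite in_itv.
Qed.

(** The Lebesgue measure of a measurable set is an infimum over Borel covers, so
    that inside a cube the set is close to a Borel set. *)
Lemma approximable_measurable a l E : 0 < l -> measurable E -> approximable a l E.
Proof.
move=> l0 mE; apply: approximable_close => // e e0.
have mQ := measurable_hcube a l; have mQE := measurableI _ _ mQ mE.
have fQE : mu (hcube a l `&` E) \is a fin_num by rewrite lebesgue_vol.
have e20 : 0 < e / 2 by lra.
have [_ [F [mF QF] <-] Fe] := lb_ereal_inf_adherent e20 fQE.
pose G : set V := \bigcup_k F k.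
have mG : measurable G.
  by apply: bigcupT_measurable => k; exact: measurable_Rn_borel.
exists G; split.
  by apply: approximable_bigcup => // k; exact: approximable_borel.
have Gle : (mu G <= \sum_(k <oo) borel_lebesgue n (F k))%E.
  rewrite lebesgueRn_borel; last by exact: bigcupT_measurable.
  by apply: measure_sigma_subadditive => //; exact: bigcupT_measurable.
have GE : (mu (G `\` (hcube a l `&` E)) <= (e / 2)%:E)%E.
  have : (mu G < mu (hcube a l `&` E) + (e / 2)%:E)%E by exact: le_lt_trans Fe.
  have -> : mu G = (mu (hcube a l `&` E) + mu (G `\` (hcube a l `&` E)))%E.
    rewrite -[in LHS](setUIDK G (hcube a l `&` E)) measureU.
    - by rewrite (setIidr QF).
    - by rewrite (setIidr QF).
    - exact: measurableD.
    - by rewrite -subset0 => x [[_ ?] [_ ]].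
  by rewrite lteD2lE// => /ltW.
rewrite -lte_fin -lebesgue_vol; [|done|exact: measurable_symd].
apply: (@le_lt_trans _ _ (e / 2)%:E); last by rewrite lte_fin; lra.
apply: le_trans GE; apply: le_measure; rewrite ?inE.
- by apply: measurableI => //; exact: measurable_symd.
- exact: measurableD.
- move=> x [Qx [[Gx Ex]|[Ex Gx]]]; first by split=> // -[].
  by exfalso; apply: Gx; apply: QF.
Qed.

End approximation_all.

(** * Doubling and stopping cubes *)

Section A_infty.
Local Open Scope classical_set_scope.
Local Open Scope ring_scope.
Context {R : realType} {n : nat}.
Local Notation V := (Rn R n).
Local Notation mu := (@lebesgueRn R n).
Implicit Types (a : 'I_n -> R) (l : R) (A B D E : set V).

Lemma mass_setD (w : V -> R) a l A B : loc_weight w -> 0 < l ->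
  measurable A -> measurable B -> B `<=` A -> A `<=` hcube a l ->
  mass w (A `\` B) = mass w A - mass w B.
Proof.
move=> ww l0 mA mB BA AQ; rewrite (massID ww l0 mA mB AQ) (setIidr BA).
by rewrite addrC addKr.
Qed.

Lemma bernoulli_ineq (x : R) k : 0 <= x <= 1 -> 1 - k%:R * x <= (1 - x) ^+ k.
Proof.
move=> /andP[x0 x1]; elim: k => [|k IH]; first by rewrite mul0r subr0 expr0.
rewrite exprS; apply: le_trans (ler_wpM2l _ IH); last by rewrite subr_ge0.
have : 0 <= k%:R * x ^+ 2 by rewrite mulr_ge0 ?sqr_ge0.
by rewrite -natr1 => h; nra.
Qed.

Lemma exists_expr_small (rho e : R) : 0 <= rho < 1 -> 0 < e -> exists k, rho ^+ k < e.
Proof.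
move=> /andP[r0 r1] e0.
have cv : (fun k => rho ^+ k) @ \oo --> (0 : R).
  by apply: cvg_expr; rewrite ger0_norm.
have [k _ /(_ k (leqnn _))] := cvgr_lt _ cv _ e0.
by exists k.
Qed.

Variables (w : V -> R) (ww : loc_weight w).
Variable alpha : R.
Hypothesis alpha01 : 0 < alpha < 1.
Hypothesis small_half : forall a l A, 0 < l -> measurable A ->
  A `<=` hcube a l -> vol A <= alpha * l ^+ n ->
  mass w A <= mass w (hcube a l) / 2.

(** Cubes of edge [s] sharing with the cube of edge [l] the vertex that its child
    [b] has in common with it. *)
Definition corner a l (b : {ffun 'I_n -> bool}) (s : R) (i : 'I_n) : R :=
  a i + (if b i then l - s else 0).

Lemma corner_sub a l b s t : s <= t ->
  hcube (corner a l b s) s `<=` hcube (corner a l b t) t.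
Proof.
move=> st x Qx i; have := Qx i; rewrite /corner.
by case: (b i) => /andP[h1 h2]; apply/andP; split; lra.
Qed.

(** If [s / t] is close to 1, what the cube of edge [t] has outside the one of
    edge [s] is a small portion of its volume, hence carries at most half of its
    mass. Iterating along cubes whose edges shrink geometrically loses a factor
    2 at each step. *)
Lemma corner_mass : exists2 rho, 0 < rho < 1 & forall a l b k s, 0 < l ->
  0 < s <= l -> rho ^+ k * l <= s ->
  2^-1 ^+ k * mass w (hcube a l) <= mass w (hcube (corner a l b s) s).
Proof.
have [al0 al1] := andP alpha01.
have n1 : 1 <= n.+1%:R :> R by rewrite ler1n.
(* By Bernoulli's inequality (1 - x)^n >= 1 - n x >= 1 - alpha. *)
pose x := alpha / n.+1%:R.
have x0 : 0 < x by rewrite divr_gt0// (lt_le_trans _ n1).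
have x1 : x < 1.
  by rewrite ltr_pdivrMr ?(lt_le_trans _ n1)// mul1r (lt_le_trans al1).
have xn : 1 - (1 - x) ^+ n <= alpha.
  have h : 1 - n%:R * x <= (1 - x) ^+ n by apply: bernoulli_ineq; rewrite !ltW.
  have : n.+1%:R * x = alpha by rewrite /x mulrC divfK// pnatr_eq0.
  rewrite -natr1 mulrDl mul1r => ?; lra.
exists (1 - x); first by apply/andP; split; lra.
have rho0 : 0 < 1 - x by lra.
move=> a l b k s l0; elim: k s => [|k IH] s /andP[s0 sl].
  rewrite !expr0 !mul1r => ls; have -> : s = l by apply/eqP; rewrite eq_le sl ls.
  rewrite (_ : corner a l b l = a)//; apply/funext => i.
  by rewrite /corner subrr; case: ifP; rewrite addr0.
(* The next larger cube of the chain, cut off at the cube itself. *)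
move=> ks; pose t := Num.min l (s / (1 - x)).
have s_le : s <= s / (1 - x) by rewrite ler_pdivlMr//; nra.
have st : s <= t by rewrite le_min sl s_le.
have tl : t <= l by rewrite ge_min lexx.
have t0 : 0 < t by lra.
have ts : (1 - x) * t <= s.
  by rewrite mulrC -ler_pdivlMr// ge_min lexx orbT.
have kt : (1 - x) ^+ k * l <= t.
  rewrite le_min; apply/andP; split.
    by rewrite ler_piMl ?(ltW l0)// exprn_ile1 ?(ltW rho0)//; lra.
  by rewrite ler_pdivlMr// mulrAC -exprSr.
have := IH t _ kt; rewrite t0 tl => /(_ isT) {}IH.
have sub := @corner_sub a l b s t st.
have mt := @measurable_hcube R n (corner a l b t) t.
have ms := @measurable_hcube R n (corner a l b s) s.
have := small_half t0 (measurableD mt ms) (@subDsetl _ _ _).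
rewrite /vol (mass_setD loc_weight1 t0 mt ms sub (@subset_refl _ _)) -/vol !vol_hcube//.
rewrite (mass_setD ww t0 mt ms sub (@subset_refl _ _)) => h.
have {}h : mass w (hcube (corner a l b t) t) / 2 <= mass w (hcube (corner a l b s) s).
  suff /h : t ^+ n - s ^+ n <= alpha * t ^+ n by lra.
  have : ((1 - x) * t) ^+ n <= s ^+ n.
    by apply: lerXn2r => //; rewrite ?nnegrE ?ltW// mulr_gt0.
  rewrite exprMn => h1.
  have : (1 - (1 - x) ^+ n) * t ^+ n <= alpha * t ^+ n.
    by rewrite ler_wpM2r ?exprn_ge0// ltW.
  lra.
apply: le_trans h; rewrite exprSr mulrAC ler_wpM2r// ?invr_ge0//.
Qed.

(** A child is reached from its parent by a fixed number of the steps of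
    [corner_mass]. The bound [4^-1] makes [theta] at most 1/16 in
    [level_set_decay]. *)
Lemma doubling : exists2 d, 0 < d <= 4^-1 & forall a l b, 0 < l ->
  d * mass w (hcube a l) <= mass w (hcube (child a l b) (l / 2)).
Proof.
have [rho /andP[rho0 rho1] h] := corner_mass.
have [k kr] : exists k, rho ^+ k < 2^-1.
  by apply: exists_expr_small; [rewrite (ltW rho0)|lra].
exists (2^-1 ^+ k / 4).
  have h1 : 0 < (2^-1 : R) ^+ k by rewrite exprn_gt0.
  have h2 : (2^-1 : R) ^+ k <= 1 by rewrite exprn_ile1//; lra.
  by apply/andP; split; lra.
move=> a l b l0.
have -> : hcube (child a l b) (l / 2) = hcube (corner a l b (l / 2)) (l / 2).
  congr hcube; apply/funext => i; rewrite /child /corner.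
  by case: (b i) => //; congr (_ + _); lra.
have : 2^-1 ^+ k * mass w (hcube a l) <=
    mass w (hcube (corner a l b (l / 2)) (l / 2)).
  apply: h => //; first by apply/andP; split; lra.
  by rewrite mulrC ler_pM2l// ltW.
have h0 : 0 <= 2^-1 ^+ k * mass w (hcube a l).
  by rewrite mulr_ge0 ?exprn_ge0// mass_ge0.
rewrite mulrAC; lra.
Qed.

Section stopping.
Variables (d T psi : R) (E : set V).
Hypotheses (mE : measurable E) (T0 : 0 < T) (d0 : 0 < d).
Hypothesis child_ge : forall a l b, 0 < l ->
  d * mass w (hcube a l) <= mass w (hcube (child a l b) (l / 2)).
Hypothesis stopped : forall a l, 0 < l ->
  d * T * l ^+ n <= mass w (hcube a l) < T * l ^+ n ->
  vol (hcube a l `&` E) <= psi * l ^+ n.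
Hypothesis unstopped : forall a l, 0 < l ->
  T * l ^+ n <= mass w (hcube a l) -> alpha * l ^+ n <= vol (hcube a l `\` E).

(** The properties kept of the union [U] of the maximal dyadic subcubes, of
    generation at most [N], on which the average of [w] is below the threshold
    [T]. The last one comes from the remaining subcubes of generation [N]: each of
    them has a portion [alpha] outside [E]. *)
Definition stopping_set N a l (U : set V) := [/\ measurable U,
  mass w (hcube a l `&` U) <= T * vol (hcube a l `&` U),
  vol (hcube a l `&` (U `&` E)) <= psi * vol (hcube a l `&` U) &
  forall D, measurable D -> adapted N a l D ->
    alpha * vol (hcube a l `&` (D `\` U)) <= vol (hcube a l `&` ((D `\` U) `\` E))].

(** By induction on [N]: a child with average below [T] is stopped, and doubling
    keeps its average above [d * T]; the induction hypothesis handles the other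
    children. *)
Lemma exists_stopping_set N a l : 0 < l -> T * l ^+ n <= mass w (hcube a l) ->
  exists U, stopping_set N a l U.
Proof.
elim: N a l => [|N IH] a l l0 Tl.
  exists set0; split=> //.
  - by rewrite setI0 /vol /mass !integral_set0 mulr0.
  - by rewrite set0I setI0 /vol /mass !integral_set0 mulr0.
  - move=> D mD; rewrite setD0 /= => -[QD|QD].
      rewrite setIDA (setIidl QD) vol_hcube//; exact: unstopped.
    rewrite setIDA (_ : _ `&` D = set0).
      by rewrite set0D /vol /mass !integral_set0 mulr0.
    by rewrite -subset0 => x [/QD].
have l20 : 0 < l / 2 by lra.
have /choice[U hU] : forall b : {ffun 'I_n -> bool}, exists U, stopping_set N (child a l b) (l / 2) U.
  move=> b; case: (leP (T * (l / 2) ^+ n) (mass w (hcube (child a l b) (l / 2)))) => h.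
    exact: IH.
  have hv : mass (cst 1) (hcube (child a l b) (l / 2)) = (l / 2) ^+ n by exact: vol_hcube.
  exists setT; split=> //.
  - by rewrite setIT vol_hcube// ltW.
  - rewrite setIT setTI vol_hcube//; apply: stopped => //.
    rewrite h andbT; apply: le_trans (child_ge a b l0).
    rewrite -mulrA ler_wpM2l ?(ltW d0)//; apply: le_trans Tl.
    rewrite ler_wpM2l ?(ltW T0)//; apply: lerXn2r; rewrite ?nnegrE; lra.
  - by move=> D _ _; rewrite setDT set0D setI0 /vol /mass !integral_set0 mulr0.
pose W := \big[setU/set0]_(b : {ffun 'I_n -> bool}) (hcube (child a l b) (l / 2) `&` U b).
have WU b A : hcube (child a l b) (l / 2) `&` (W `&` A) = hcube (child a l b) (l / 2) `&` (U b `&` A).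
  apply/seteqP; split=> x [Qx [Wx Ax]]; split=> //; split=> //.
    move: Wx; rewrite /W -bigcup_seq => -[c _ [Qc Uc]].
    by rewrite (child_inj Qx Qc).
  by rewrite /W -bigcup_seq; exists b => //=; rewrite mem_index_enum.
have WD b A : hcube (child a l b) (l / 2) `&` (A `\` W) = hcube (child a l b) (l / 2) `&` (A `\` U b).
  apply/seteqP; split=> x [Qx [Ax nx]]; split=> //; split=> // Ux; apply: nx.
    by have [_ []//] : (hcube (child a l b) (l / 2) `&` (W `&` setT)) x by rewrite WU; split.
  by have [_ []//] : (hcube (child a l b) (l / 2) `&` (U b `&` setT)) x by rewrite -WU; split.
have mW : measurable W.
  apply: bigsetU_measurable => b _; apply: measurableI; first exact: measurable_hcube.
  by have [] := hU b.
exists W; rewrite /stopping_set.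
have mWE := measurableI _ _ mW mE.
split=> //.
- rewrite /vol !mass_children ?mulr_sumr//; try exact: loc_weight1.
  apply: ler_sum => b _; rewrite -(setIT W) WU setIT; by have [] := hU b.
- rewrite /vol !mass_children ?mulr_sumr//; try exact: loc_weight1.
  apply: ler_sum => b _; rewrite WU -(setIT W) WU setIT; by have [] := hU b.
- move=> D mD aD; have mDW := measurableD mD mW.
  rewrite /vol !mass_children ?mulr_sumr//; try exact: loc_weight1; last exact: measurableD.
  apply: ler_sum => b _; have [_ _ _ h] := hU b.
  have DAC (A B C : set V) : A `\` B `\` C = A `\` C `\` B.
    by rewrite setDDl setUC -setDDl.
  by rewrite (DAC D W E) !WD (DAC D E (U b)); exact: h.
Qed.

End stopping.

End A_infty.

(** * Decay of the measure of sublevel sets *)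

Section monotone_integral.
Local Open Scope classical_set_scope.
Local Open Scope ring_scope.

(** Positive and negative parts are compared separately, whether or not their
    integrals are finite. *)
Lemma le_integral_measurable d (T : measurableType d) (R : realType)
    (mu : {measure set T -> \bar R}) (D : set T) (f g : T -> \bar R) :
  measurable D -> measurable_fun D f -> measurable_fun D g ->
  (forall x, D x -> (f x <= g x)%E) ->
  (\int[mu]_(x in D) f x <= \int[mu]_(x in D) g x)%E.
Proof.
move=> mD mf mg fg; rewrite integralE [leRHS]integralE.
have fg' : {in [set` D], forall x, (f x <= g x)%E} by move=> x; rewrite inE => /set_mem; exact: fg.
apply: leeB; apply: ge0_le_integral => //; try exact: measurable_funepos; try exact: measurable_funeneg.
- by move=> x Dx; apply: (@funepos_le _ _ [set` D]) => //; rewrite inE; exact: mem_set.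
- by move=> x Dx; apply: (@funeneg_le _ _ [set` D]) => //; rewrite inE; exact: mem_set.
Qed.

End monotone_integral.

Section layer_sums.
Local Open Scope classical_set_scope.
Local Open Scope ring_scope.
Context d (T : measurableType d) (R : realType) (mu : {measure set T -> \bar R}).

Lemma measurable_layer_sum (A : (set T)^nat) (c : R^nat) :
  (forall k, measurable (A k)) -> (forall k, 0 <= c k) ->
  measurable_fun setT (fun x => (\sum_(k <oo) (c k * \1_(A k) x)%:E)%E).
Proof.
move=> mA c0.
apply: (@ge0_emeasurable_sum _ _ _ _ (fun k x => (c k * \1_(A k) x)%:E) xpredT).
- by move=> k x _ _; rewrite lee_fin mulr_ge0.
- by move=> k _; apply/measurable_EFinP; apply: measurable_funM.
Qed.

(** Integration term by term, with a geometric bound for the terms. *)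
Lemma integral_layer_sum (D : set T) (A : (set T)^nat) (c : R^nat) (K z : R) :
  measurable D -> (forall k, measurable (A k)) -> (forall k, 0 <= c k) ->
  0 <= z < 1 -> (forall k, ((c k)%:E * mu (A k `&` D) <= (K * z ^+ k)%:E)%E) ->
  (\int[mu]_(x in D) (\sum_(k <oo) (c k * \1_(A k) x)%:E) <= (K / (1 - z))%:E)%E.
Proof.
move=> mD mA c0 /andP[z0 z1] h.
have mf k : measurable_fun D (fun x => (c k * \1_(A k) x)%:E).
  by apply/measurable_EFinP; apply: measurable_funM.
have f0 k x : (0 <= (c k * \1_(A k) x)%:E)%E by rewrite lee_fin mulr_ge0.
rewrite integral_nneseries//.
have cv : (fun N => (\sum_(0 <= k < N) (K * z ^+ k)%:E)%E) @ \oo --> (K / (1 - z))%:E.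
  apply: cvg_EFin; first by apply: nearW => N; rewrite sumEFin.
  have := @cvg_geometric_series R K z; rewrite ger0_norm// => /(_ z1).
  apply: cvg_trans; apply: near_eq_cvg; apply: nearW => N /=.
  by rewrite sumEFin.
rewrite -(cvg_lim _ cv)//; apply: lee_lim.
- by apply: is_cvg_nneseries => k _ _; exact: integral_ge0.
- by apply/cvg_ex; exists (K / (1 - z))%:E.
- apply: nearW => N; apply: lee_sum => k _; apply: le_trans (h k).
  under eq_integral do rewrite EFinM.
  by rewrite ge0_integralZl_EFin// ?integral_indic//; exact/measurable_EFinP.
Qed.

End layer_sums.

Section level_decay.
Local Open Scope classical_set_scope.
Local Open Scope ring_scope.
Context {R : realType} {n : nat}.
Local Notation V := (Rn R n).
Local Notation mu := (@lebesgueRn R n).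
Implicit Types (a : 'I_n -> R) (l : R) (A B D E : set V).

Lemma measurable_sublevel (w : V -> R) (t : R) : measurable_fun setT w ->
  measurable [set x | w x < t].
Proof.
move=> mw; have := mw measurableT `]-oo, t[%classic (measurable_itv _).
by rewrite setTI; congr measurable; apply/seteqP; split=> x /=; rewrite in_itv.
Qed.

Lemma le_vol_hcube a l A : 0 < l -> measurable A -> vol (hcube a l `&` A) <= l ^+ n.
Proof.
move=> l0 mA; rewrite -(@vol_hcube R n a l)//.
have := @le_volI _ _ a l A setT l0 mA measurableT (@subsetT _ _).
by rewrite setIT.
Qed.

Lemma mass_le_cst (w : V -> R) a l A (c : R) : loc_weight w -> 0 < l ->
  measurable A -> (forall x, A x -> w x <= c) ->
  mass w (hcube a l `&` A) <= c * vol (hcube a l `&` A).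
Proof.
move=> ww l0 mA wc.
have mQA : measurable (hcube a l `&` A).
  by apply: measurableI => //; exact: measurable_hcube.
rewrite -lee_fin EFinM -(mass_fin ww)// -lebesgue_vol//.
have [mw _ _] := ww.
apply: (@le_trans _ _ (\int[mu]_(x in hcube a l `&` A) (cst c%:E x))%E); last first.
  by rewrite integral_cst.
have mwQ : measurable_fun (hcube a l `&` A) (EFin \o w).
  by apply/measurable_EFinP; exact: measurable_funTS mw.
have wle x : (hcube a l `&` A) x -> ((w x)%:E <= c%:E)%E.
  by move=> [_ Ax]; rewrite lee_fin; exact: wc.
exact: (le_integral_measurable mu mQA mwQ (measurable_cst _) wle).
Qed.

Variables (w : V -> R) (ww : loc_weight w).
Variable alpha : R.
Hypothesis alpha01 : 0 < alpha < 1.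
Hypothesis small_half : forall a l A, 0 < l -> measurable A ->
  A `<=` hcube a l -> vol A <= alpha * l ^+ n ->
  mass w A <= mass w (hcube a l) / 2.
Hypothesis mass_gt0 : forall a l, 0 < l -> 0 < mass w (hcube a l).

(** Calderon-Zygmund argument. Stop at the subcubes with average below a quarter
    of the average [avg] of the cube. They carry at most a quarter of the mass, so
    that by [small_half] they miss a portion [alpha] of the cube. By doubling their
    averages are at least [theta * avg], so that the induction hypothesis bounds
    the part of the sublevel set that they contain. The rest of it is null: an
    unstopped cube has a portion [alpha] outside the sublevel set, while dyadic
    sets approximate the sublevel set. *)
Lemma level_set_decay : exists2 theta, 0 < theta < 1 & forall k a l, 0 < l ->
  vol (hcube a l `&` [set x | w x < theta ^+ k * (mass w (hcube a l) / l ^+ n)])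
    <= (1 - alpha) ^+ k * l ^+ n.
Proof.
have [al0 al1] := andP alpha01; have [mw w0 _] := ww.
have [d /andP[d0 d1] child_ge] := doubling ww alpha01 small_half.
exists (d / 4); first by apply/andP; split; lra.
have th0 : 0 < d / 4 by lra.
elim=> [|k IH] a l l0.
  by rewrite !expr0 !mul1r le_vol_hcube//; exact: measurable_sublevel.
have mQ := @measurable_hcube R n.
have ln0 (m : R) : 0 < m -> 0 < m ^+ n by move=> ?; exact: exprn_gt0.
pose M := mass w (hcube a l); pose avg := M / l ^+ n; pose T := avg / 4.
have M0 : 0 < M := mass_gt0 a l0.
have avg0 : 0 < avg by rewrite divr_gt0// ln0.
have T0 : 0 < T by rewrite /T; lra.
pose E := [set x | w x < (d / 4) ^+ k.+1 * avg].
have mE : measurable E by exact: measurable_sublevel.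
pose psi := (1 - alpha) ^+ k.
have psi0 : 0 <= psi by rewrite exprn_ge0//; lra.
have stopped a' l' : 0 < l' ->
    d * T * l' ^+ n <= mass w (hcube a' l') < T * l' ^+ n ->
    vol (hcube a' l' `&` E) <= psi * l' ^+ n.
  move=> l'0 /andP[h _]; apply: le_trans (IH a' _ l'0); apply: le_volI => //.
    exact: measurable_sublevel.
  move=> x [_ /= xE]; apply: (lt_le_trans xE).
  rewrite exprSr -mulrA ler_wpM2l ?exprn_ge0 ?(ltW th0)//.
  rewrite ler_pdivlMr ?ln0//; apply: le_trans h; rewrite /T; lra.
have unstopped a' l' : 0 < l' -> T * l' ^+ n <= mass w (hcube a' l') ->
    alpha * l' ^+ n <= vol (hcube a' l' `\` E).
  (* Otherwise half of the mass would lie in E, where w is at most T / 4. *)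
  move=> l'0 h; rewrite leNgt; apply/negP => /ltW lt.
  have := small_half l'0 (measurableD (mQ a' l') mE) (@subDsetl _ _ _) lt.
  have := massID ww l'0 (mQ a' l') mE (@subset_refl _ _).
  have := @mass_le_cst w a' l' E ((d / 4) ^+ k.+1 * avg) ww l'0 mE (fun x => @ltW _ _ _ _).
  have : (d / 4) ^+ k.+1 * avg * vol (hcube a' l' `&` E) <= T / 4 * l' ^+ n.
    have th_avg : 0 <= (d / 4) ^+ k.+1 * avg.
      by apply: mulr_ge0; [rewrite exprn_ge0// ltW|exact: ltW].
    apply: ler_pM; rewrite ?vol_ge0//.
      have : (d / 4) ^+ k.+1 <= 16^-1.
        rewrite exprS; have : (d / 4) ^+ k <= 1 by rewrite exprn_ile1 ?(ltW th0)//; lra.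
        have : 0 <= (d / 4) ^+ k by rewrite exprn_ge0// ltW.
        nra.
      rewrite /T => ?; nra.
    exact: le_vol_hcube.
  have := mass_gt0 a' l'0.
  lra.
have TM : T * l ^+ n <= M.
  have -> : M = avg * l ^+ n by rewrite /avg divfK// gt_eqF// ln0.
  by apply: ler_wpM2r; [exact/ltW/ln0|rewrite /T; lra].
have Ub U : measurable U -> mass w (hcube a l `&` U) <= T * vol (hcube a l `&` U) ->
    vol (hcube a l `&` U) <= (1 - alpha) * l ^+ n.
  move=> mU h.
  have hv := massID loc_weight1 l0 (mQ a l) mU (@subset_refl _ _).
  have hw := massID ww l0 (mQ a l) mU (@subset_refl _ _).
  rewrite -/vol vol_hcube// in hv.
  have v0 := @vol_ge0 R n (hcube a l `\` U).
  have : ~ (vol (hcube a l `\` U) <= alpha * l ^+ n).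
    move=> /(small_half l0 (measurableD (mQ a l) mU) (@subDsetl _ _ _)).
    have : T * vol (hcube a l `&` U) <= M / 4.
      have -> : M / 4 = T * l ^+ n.
        by rewrite /T /avg mulrAC divfK// gt_eqF// ln0.
      by rewrite ler_wpM2l ?(ltW T0)//; lra.
    rewrite -/M in hw *; lra.
  move=> /negP; rewrite -ltNge; lra.
rewrite -/M -/avg -/E; apply/ler_addgt0Pr => e0 e0_gt0.
pose e := e0 / (1 + alpha^-1).
have ai0 : 0 < alpha^-1 by rewrite invr_gt0.
have e_gt0 : 0 < e by rewrite divr_gt0//; lra.
have eE : e + alpha^-1 * e = e0.
  by rewrite /e; field; rewrite gt_eqF//=; lra.
have [_ /(_ _ e_gt0)[N [D [mD aD De]]]] := approximable_measurable a l0 mE.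
have [U [mU wU EU DU]] := exists_stopping_set ww mE T0 d0 child_ge stopped unstopped N l0 TM.
have := massID loc_weight1 l0 (measurableI _ _ (mQ a l) mE) mU (@subIsetl _ _ _).
rewrite -/vol => ->; rewrite -eE; apply: lerD.
  rewrite -setIA [E `&` U]setIC; apply: (le_trans EU).
  rewrite exprSr -/psi -mulrA; apply: ler_wpM2l => //; exact: Ub.
rewrite -setIDA.
have mEU := measurableD mE mU; have mDU := measurableD mD mU.
have mED := measurableD mE mD.
have : vol (hcube a l `&` (E `\` U)) <= vol (hcube a l `&` ((E `\` D) `|` (D `\` U))).
  apply: le_volI => //; first exact: measurableU.
  move=> x [_ [Ex Ux]]; have [Dx|Dx] := pselect (D x); by [right|left].
move=> h; apply: (le_trans h); apply: (le_trans (vol_setU_le a l0 mED mDU)).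
apply: lerD.
  apply: ltW; apply: le_lt_trans De; apply: le_volI => //.
    exact: measurable_symd.
  by move=> x [_ ?]; right.
rewrite mulrC ler_pdivlMr// mulrC; apply: (le_trans (DU _ mD aD)).
apply: ltW; apply: le_lt_trans De; apply: le_volI => //.
- exact: measurableD.
- exact: measurable_symd.
- by move=> x [_ [[? _] ?]]; left.
Qed.

End level_decay.

(** * The mean of the logarithm *)

Section log_inv.
Local Open Scope classical_set_scope.
Local Open Scope ring_scope.
Context d (T : measurableType d) (R : realType).

Lemma lne_inver (t : R) : 0 <= t ->
  lne (t%:E^-1)%E = (if t == 0%R then +oo else (- ln t)%R%:E)%E.
Proof.
rewrite le_eqVlt inver => /predU1P[<-|t0]; first by rewrite eqxx.
by rewrite gt_eqF// lneV// lne_EFin.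
Qed.

Lemma measurable_log_inv (w : T -> R) : measurable_fun setT w ->
  (forall x, 0 <= w x) -> measurable_fun setT (fun x => lne ((w x)%:E^-1)%E).
Proof.
move=> mw w0; pose F (t : R) := (if t == 0%R then +oo else (- ln t)%R%:E)%E.
have -> : (fun x => lne ((w x)%:E^-1)%E) = F \o w.
  by apply/funext => x; rewrite /= lne_inver.
apply: measurableT_comp mw; apply: measurable_fun_ifT => /=.
- exact: measurable_fun_eqr.
- exact: measurable_cst.
- apply/measurable_EFinP; apply: (measurableT_comp (@oppr_measurable _ _)).
  exact: measurable_ln.
Qed.

End log_inv.

Section log_mean.
Local Open Scope classical_set_scope.
Local Open Scope ring_scope.
Context {R : realType} {n : nat}.
Local Notation V := (Rn R n).
Local Notation mu := (@lebesgueRn R n).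
Implicit Types (a : 'I_n -> R) (l : R) (A B D E : set V).



Variables (w : V -> R) (ww : loc_weight w).
Variable alpha : R.
Hypothesis alpha01 : 0 < alpha < 1.
Hypothesis small_half : forall a l A, 0 < l -> measurable A ->
  A `<=` hcube a l -> vol A <= alpha * l ^+ n ->
  mass w A <= mass w (hcube a l) / 2.
Hypothesis mass_gt0 : forall a l, 0 < l -> 0 < mass w (hcube a l).

(** Layer-cake estimate. Where [w] lies between [theta ^+ m.+1 * avg] and
    [theta ^+ m * avg], the logarithm of [avg / w] is at most [m.+1 * - ln theta],
    which is the sum of [- ln theta] over the levels 0, ..., m whose sublevel set
    contains the point; the volumes of these sets decay geometrically. The series
    is infinite where [w] vanishes, as is the logarithm of the inverse. *)
Lemma log_inv_mean : exists C, forall a l, 0 < l ->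
  (\int[mu]_(x in hcube a l) lne ((w x)%:E^-1)
    <= ((C - ln (mass w (hcube a l) / l ^+ n)) * l ^+ n)%:E)%E.
Proof.
have [th /andP[th0 th1] decay] := level_set_decay ww alpha01 small_half mass_gt0.
have [al0 al1] := andP alpha01; have [mw w0 _] := ww.
pose L := - ln th; have L0 : 0 < L by rewrite oppr_gt0 ln_lt0// th0.
exists (L / alpha) => a l l0.
have mQ := @measurable_hcube R n a l.
have ln0 : 0 < l ^+ n by exact: exprn_gt0.
pose avg := mass w (hcube a l) / l ^+ n.
have avg0 : 0 < avg by rewrite divr_gt0// mass_gt0.
rewrite -/avg.
pose A k := [set x | w x < th ^+ k * avg].
have mA k : measurable (A k) by exact: measurable_sublevel.
pose g x := (\sum_(k <oo) (L * \1_(A k) x)%:E)%E.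
have g_ge0 x : (0 <= g x)%E.
  by apply: nneseries_ge0 => k _ _; rewrite lee_fin mulr_ge0// ltW.
have mg : measurable_fun setT g by apply: measurable_layer_sum => // k; exact: ltW.
have g_int : (\int[mu]_(x in hcube a l) g x <= (L / alpha * l ^+ n)%:E)%E.
  have -> : L / alpha * l ^+ n = L * l ^+ n / (1 - (1 - alpha)).
    by rewrite subKr mulrAC.
  apply: integral_layer_sum => // [k||k]; first exact: ltW.
    by apply/andP; split; lra.
  rewrite setIC -[X in (_ * X)%E]/(mu _) lebesgue_vol// -EFinM lee_fin -mulrA.
  rewrite ler_wpM2l ?(ltW L0)// mulrC; exact: decay.
have g_ge x k : w x < th ^+ k * avg -> ((k.+1%:R * L)%:E <= g x)%E.
  move=> wk; apply: le_trans (nneseries_lim_ge k.+1 _); last first.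
    by move=> j _ _; rewrite lee_fin mulr_ge0// ltW.
  rewrite sumEFin lee_fin big_mkord (eq_bigr (fun=> L)).
    by rewrite sumr_const card_ord mulr_natl.
  move=> j _; rewrite indicE mem_set ?mulr1// /A /=; apply: (lt_le_trans wk).
  rewrite ler_wpM2r ?(ltW avg0)//; apply: ler_wiXn2l; rewrite ?ltW//.
  by rewrite -ltnS.
have key x : (lne ((w x)%:E^-1) <= g x + (- ln avg)%:E)%E.
  rewrite lne_inver//; case: eqP => [wx0|/eqP wx0].
    suff -> : (g x = +oo)%E by [].
    apply/eqyP => r r0.
    pose k := Num.truncn (r / L).
    have h : r < k.+1%:R * L by rewrite -ltr_pdivrMr// truncnS_gt.
    apply: le_trans (g_ge x k _); first by rewrite lee_fin ltW.
    by rewrite wx0 mulr_gt0// exprn_gt0.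
  have wx : 0 < w x by rewrite lt_neqAle eq_sym wx0 w0.
  have [aw|wa] := leP avg (w x).
    apply: le_trans (leeDr _ (g_ge0 x)).
    by rewrite lee_fin lerN2 ler_ln.
  have [k0 kP] : exists k, th ^+ k * avg <= w x.
    have [k kr] : exists k, th ^+ k < w x / avg.
      by apply: exists_expr_small; [rewrite (ltW th0)|exact: divr_gt0].
    by exists k; rewrite -ler_pdivlMr// ltW.
  pose P k := th ^+ k * avg <= w x.
  have exP : exists k, P k by exists k0.
  case: (ex_minnP exP) => -[|m] Pm mmin.
    by move: Pm; rewrite /P expr0 mul1r leNgt wa.
  have wm : w x < th ^+ m * avg.
    by rewrite ltNge; apply/negP => /mmin; rewrite ltnn.
  apply: (@le_trans _ _ ((m.+1%:R * L)%:E + (- ln avg)%:E)%E); last first.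
    by rewrite leeD2r// g_ge.
  rewrite -EFinD lee_fin.
  have : ln (th ^+ m.+1 * avg) <= ln (w x) by rewrite ler_ln ?posrE// mulr_gt0// exprn_gt0.
  rewrite lnM ?posrE ?exprn_gt0// lnXn// /L -mulr_natl; lra.
apply: (@le_trans _ _ (\int[mu]_(x in hcube a l) (g x + (- ln avg)%:E))%E).
  have m1 := measurable_funTS (D := hcube a l) (measurable_log_inv mw w0).
  have m2 : measurable_fun (hcube a l) (fun x => g x + (- ln avg)%:E)%E.
    exact: emeasurable_funD (measurable_funTS mg) (measurable_cst _).
  exact: le_integral_measurable mQ m1 m2 (fun x _ => key x).
have fin_mu : (mu (hcube a l) = (l ^+ n)%:E)%E by exact: lebesgue_hcube.
rewrite integralD//; last 2 first.
- apply/integrableP; split; first exact: measurable_funTS mg.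
  under eq_integral do rewrite gee0_abs//.
  exact: le_lt_trans g_int (ltry _).
- apply/integrableP; split=> //.
  by rewrite integral_cst// -[X in (_ * X)%E]/(mu _) fin_mu -EFinM ltry.
rewrite integral_cst// -[X in (_ * X)%E]/(mu _) fin_mu mulrBl EFinB -EFinM mulNr EFinN.
exact: leeD2r.
Qed.

End log_mean.

(** * Log-Hoelder continuous exponents *)

Section exponent.
Local Open Scope classical_set_scope.
Local Open Scope ring_scope.
Context {R : realType} {n : nat}.
Local Notation V := (Rn R n).
Local Notation mu := (@lebesgueRn R n).
Local Notation edist := Defs.edist.
Implicit Types (a : 'I_n -> R) (l : R) (A B D E : set V).

Lemma powRE (t u : R) : 0 < t -> t `^ u = expR (u * ln t).
Proof. by move=> t0; rewrite /powR gt_eqF. Qed.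

Lemma edist_le (x y : V) l : 0 <= l ->
  (forall i, `|rn_coord x i - rn_coord y i| <= l) -> edist x y <= n%:R * l.
Proof.
move=> l0 h; rewrite /edist -[leRHS]ger0_norm ?mulr_ge0// -sqrtr_sqr.
rewrite ler_wsqrtr//; apply: (@le_trans _ _ (\sum_(i < n) l ^+ 2)).
  by apply: ler_sum => i _; rewrite -real_normK ?num_real// lerXn2r ?nnegrE//; exact: h.
rewrite sumr_const card_ord exprMn -[leLHS]mulr_natl ler_wpM2r ?sqr_ge0//.
by rewrite -natrX ler_nat; case: (n) => // m; rewrite -mulnn leq_pmulr.
Qed.

Lemma le_coord_enorm (x : V) i : `|rn_coord x i| <= enorm x.
Proof.
rewrite /enorm -sqrtr_sqr ler_wsqrtr// (bigD1 i)//= lerDl.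
by apply: sumr_ge0 => j _; rewrite sqr_ge0.
Qed.

Lemma enorm_ge0 (x : V) : 0 <= enorm x. Proof. exact: sqrtr_ge0. Qed.

Lemma ln_enorm_ge1 (x : V) : 1 <= ln (expR 1 + enorm x).
Proof.
have e0 : 0 < expR 1 :> R by exact: expR_gt0.
rewrite -[leLHS](@expRK R); rewrite ler_ln ?posrE// ?lerDl ?enorm_ge0//.
by rewrite ltr_wpDr// enorm_ge0.
Qed.

Lemma ae_hcube_nonempty a l (P : V -> Prop) : 0 < l ->
  {ae mu, forall x, P x} -> exists2 x, hcube a l x & P x.
Proof.
move=> l0 [N [mN N0 PN]]; apply: contrapT => h.
have QN : hcube a l `<=` N.
  by move=> x Qx; apply: PN => Px; apply: h; exists x.
have : (mu (hcube a l) <= mu N)%E.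
  by apply: le_measure; rewrite ?inE//; exact: measurable_hcube.
rewrite lebesgue_hcube// [X in (_ <= X)%E](_ : _ = 0%E)//.
by rewrite lee_fin leNgt exprn_gt0.
Qed.

Definition point_of (c : 'I_n -> R) : V := [tuple c i | i < n].

Lemma rn_coord_point c i : rn_coord (point_of c) i = c i.
Proof. by rewrite /rn_coord tnth_mktuple. Qed.

Variable r : V -> R.
Hypotheses (n_gt0 : (0 < n)%N) (r_LH : LH r).

Lemma decay_bounded q C : (forall x, `|r x - q| <= C / ln (expR 1 + enorm x)) ->
  0 < C -> forall x, `|r x - q| <= C.
Proof.
move=> h C0 x; apply: (le_trans (h x)); rewrite ler_pdivrMr.
  by rewrite ler_peMr ?ln_enorm_ge1// ltW.
exact: lt_le_trans (ln_enorm_ge1 x).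
Qed.

(** Oscillation of the exponent on a cube of edge [l]: this is what makes
    [l `^ (r x - r y)] bounded above and below. For small [l] it is local
    log-Hoelder continuity; otherwise [ln l] is bounded, and so is [r] by the
    decay condition. *)
Lemma log_Holder_cube : exists2 K, 0 < K & forall (x y : V) l, 0 < l <= 1 ->
  (forall i, `|rn_coord x i - rn_coord y i| <= l) ->
  `|r x - r y| * - ln l <= K.
Proof.
have [_ [C0 C0_gt0 loc] [q [C [_ C_gt0 dec]]]] := r_LH.
have bnd := decay_bounded dec C_gt0.
have n1 : 1 <= n%:R :> R by rewrite ler1n.
pose l0 : R := (4 * n%:R ^+ 2)^-1.
have n20 : 0 < 4 * n%:R ^+ 2 :> R by rewrite mulr_gt0// exprn_gt0// (lt_le_trans _ n1).
have l0_gt0 : 0 < l0 by rewrite invr_gt0.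
have n2 : 1 <= n%:R ^+ 2 :> R by rewrite exprn_ege1.
have l0_lt1 : l0 < 1 by rewrite invf_lt1//; lra.
have nlnl0 : 0 < - ln l0 by rewrite oppr_gt0 ln_lt0// l0_gt0.
exists (2 * C0 + 2 * C * - ln l0); first by rewrite addr_gt0// !mulr_gt0.
move=> x y l /andP[l_gt0 l1] xy.
have lnl : 0 <= - ln l by rewrite oppr_ge0 ln_le0.
have [ll|ll] := leP l l0; last first.
  have h1 : - ln l <= - ln l0 by rewrite lerN2 ler_ln ?posrE// ltW.
  have h2 : `|r x - r y| <= 2 * C.
    have -> : r x - r y = (r x - q) - (r y - q) by ring.
    apply: (le_trans (ler_normB _ _)); have := bnd x; have := bnd y; lra.
  apply: (@le_trans _ _ (2 * C * - ln l0)); last by lra.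
  exact: ler_pM.
have d := edist_le (ltW l_gt0) xy.
have nl : n%:R * l <= (4 * n%:R)^-1.
  have -> : (4 * n%:R)^-1 = n%:R * l0 :> R by rewrite /l0; field; rewrite gt_eqF// (lt_le_trans _ n1).
  by rewrite ler_wpM2l// lt0r_neq0.
have nl4 : n%:R * l <= 4^-1.
  apply: (le_trans nl); rewrite lef_pV2 ?posrE//; lra.
have d2 : edist x y < 1 / 2 by lra.
have C2 : 0 <= 2 * C * - ln l0 by rewrite !mulr_ge0// ?ltW.
apply: (@le_trans _ _ (2 * C0)); last by lra.
have := loc x y d2; have [->|dn0] := eqVneq (edist x y) 0.
  rewrite ln0// invr0 mulr0 oppr0 => h.
  by rewrite (le_trans (ler_wpM2r lnl h))// mul0r; lra.
have d0 : 0 < edist x y by rewrite lt_def dn0 sqrtr_ge0.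
(* The distance is at most n l, and (n l)^2 <= l by the choice of l0. *)
have h1 : - ln l / 2 <= - ln (edist x y).
  have : ln (edist x y) <= ln (n%:R * l) by rewrite ler_ln ?posrE ?mulr_gt0//; lra.
  have : 2 * ln (n%:R * l) <= ln l.
    rewrite mulr_natl -lnXn ?mulr_gt0//; last lra.
    rewrite ler_ln ?posrE ?exprn_gt0 ?mulr_gt0//; last lra.
    rewrite exprMn expr2 [l ^+ 2]expr2 mulrA ler_piMl ?(ltW l_gt0)//.
    have : n%:R * n%:R * l <= n%:R * n%:R * l0 by rewrite ler_wpM2l// mulr_ge0.
    have -> : n%:R * n%:R * l0 = 4^-1 :> R by rewrite /l0; field; rewrite gt_eqF// (lt_le_trans _ n1).
    lra.
  lra.
move=> h; apply: (le_trans (ler_wpM2r lnl h)).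
have [lnl0|lnl0] := eqVneq (ln l) 0; first by rewrite lnl0 oppr0 mulr0; lra.
have p : 0 < - ln l by rewrite lt_def lnl oppr_eq0 lnl0.
have pd : 0 < - ln (edist x y) by lra.
rewrite -mulrN -invrN mulrAC ler_pdivrMr//.
have : C0 * - ln l <= C0 * (2 * - ln (edist x y)) by apply: ler_wpM2l; lra.
lra.
Qed.

Variable s : R.
Hypothesis s_r : {ae mu, forall x, s <= r x}.

(** The exponent is continuous, and a cube is not a null set. *)
Lemma exponent_ge (x : V) : s <= r x.
Proof.
have [K K0 h] := log_Holder_cube.
apply/ler_addgt0Pr => e e0.
pose l := expR (- (K / e)).
have Ke : 0 < K / e by rewrite divr_gt0.
have l0 : 0 < l by exact: expR_gt0.
have l1 : l <= 1 by rewrite expR_le1 oppr_le0 ltW.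
have [y Qy sy] := ae_hcube_nonempty (rn_coord x) l0 s_r.
have := h x y l; rewrite l0 l1 expRK opprK => /(_ isT) {}h.
have : `|r x - r y| * (K / e) <= K.
  apply: h => i; have /andP[h1 h2] := Qy i.
  by rewrite ler_norml; apply/andP; split; lra.
rewrite -ler_pdivlMr// invf_div mulrCA divff ?gt_eqF// mulr1.
by rewrite ler_norml => /andP[? ?]; lra.
Qed.

Lemma limit_exponent_ge q C : 0 < C ->
  (forall x, `|r x - q| <= C / ln (expR 1 + enorm x)) -> s <= q.
Proof.
move=> C0 h; apply/ler_addgt0Pr => e e0.
pose x := point_of (fun=> expR (C / e)).
have hx : expR (C / e) <= enorm x.
  have := le_coord_enorm x (Ordinal n_gt0).
  by rewrite rn_coord_point ger0_norm ?expR_ge0.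
have Ce : 0 < C / e by rewrite divr_gt0.
have l1 : C / e <= ln (expR 1 + enorm x).
  rewrite -[leLHS](@expRK R) ler_ln ?posrE ?expR_gt0//.
    by apply: (le_trans hx); rewrite lerDr expR_ge0.
  by rewrite ltr_wpDr ?enorm_ge0// expR_gt0.
have : `|r x - q| <= e.
  apply: (le_trans (h x)); rewrite ler_pdivrMr ?(lt_le_trans Ce)//.
  by rewrite mulrC -ler_pdivrMr.
have := exponent_ge x; rewrite ler_norml => ? /andP[? ?]; lra.
Qed.

End exponent.

(** * The error term in the comparison with the exponent at infinity *)

Section key_estimate.
Local Open Scope classical_set_scope.
Local Open Scope ring_scope.
Context {R : realType} {n : nat}.
Local Notation V := (Rn R n).
Local Notation mu := (@lebesgueRn R n).
Implicit Types (a : 'I_n -> R) (l : R) (A B D E : set V).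

(** An integrable power of the function whose logarithm controls the convergence
    of the exponent at infinity. *)
Definition tail_decay (x : V) : R := (expR 1 + enorm x) ^- n.+1.

Lemma enorm_gt0 (x : V) : 0 < expR 1 + enorm x.
Proof. by rewrite ltr_wpDr ?enorm_ge0// expR_gt0. Qed.

Lemma tail_decay_ge0 x : 0 <= tail_decay x.
Proof. by rewrite invr_ge0 exprn_ge0// ltW// enorm_gt0. Qed.

Lemma measurable_tail_decay : measurable_fun setT tail_decay.
Proof.
pose f (t : R) := (expR 1 + Num.sqrt t) ^- n.+1.
pose g (x : V) : R := \sum_(i < n) rn_coord x i ^+ 2.
have mg : measurable_fun setT g.
  apply: measurable_sum => i.
  exact: measurable_funX (@measurable_rn_coord R n i).
have mf : measurable_fun setT f.
  rewrite /f; under eq_fun do rewrite -powR_invn ?addr_ge0 ?expR_ge0 ?sqrtr_ge0//.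
  apply: (measurableT_comp (@measurable_powR R _)).
  apply: measurable_funD; first exact: measurable_cst.
  apply: continuous_measurable_fun; exact: sqrt_continuous.
exact: (measurableT_comp mf mg).
Qed.

(** On the k-th of a sequence of centred cubes of edges [2 ^+ k.+1], outside the
    previous one, the function is of order [2 ^- (k * n.+1)], while the volume is of
    order [2 ^+ (k * n)]. *)
Lemma integral_tail_decay : exists2 H : R, 0 <= H &
  forall D, measurable D -> (\int[mu]_(x in D) (tail_decay x)%:E <= H%:E)%E.
Proof.
pose B k := hcube (fun=> - 2 ^+ k) (2 ^+ k.+1) : set V.
pose c k : R := 2 ^- (k * n.+1) * 2 ^+ n.+1.
have c0 k : 0 <= c k by rewrite mulr_ge0// ?invr_ge0 exprn_ge0.
have mB k : measurable (B k) by exact: measurable_hcube.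
pose K : R := 2 ^+ n.+1 * 2 ^+ n.
exists (K / (1 - 2^-1)).
  by rewrite divr_ge0 ?mulr_ge0 ?exprn_ge0//; lra.
move=> D mD.
have h : (\int[mu]_(x in D) (\sum_(k <oo) (c k * \1_(B k) x)%:E) <= (K / (1 - 2^-1))%:E)%E.
  apply: integral_layer_sum => //; first by apply/andP; split; lra.
  move=> k; apply: (@le_trans _ _ ((c k)%:E * mu (B k))%E).
    rewrite lee_wpmul2l ?lee_fin//; apply: le_measure; rewrite ?inE//.
    exact: measurableI.
  have -> : mu (B k) = ((2 ^+ k.+1) ^+ n)%:E by apply: lebesgue_hcube; exact: exprn_gt0.
  rewrite -EFinM lee_fin /c /K exprVn mulnS exprD -exprM mulSn exprD le_eqVlt.
  apply/orP; left; apply/eqP; field.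
  by rewrite !expf_neq0.
apply: le_trans h; apply: le_integral_measurable mD _ _ _.
- apply/measurable_EFinP; exact: measurable_funTS measurable_tail_decay.
- apply: measurable_funTS; exact: measurable_layer_sum.
move=> x _.
have [k0 k0P] : exists k, enorm x < 2 ^+ k.
  exists (Num.truncn (enorm x)).+1; apply: (lt_le_trans (truncnS_gt _)).
  by rewrite -natrX ler_nat ltnW// ltn_expl.
have BP k : enorm x < 2 ^+ k -> B k x.
  move=> xk i; have := le_lt_trans (le_coord_enorm x i) xk.
  by rewrite ltr_norml exprS => /andP[h1 h2]; apply/andP; split; lra.
have [k hk Bk] : exists2 k, tail_decay x <= c k & B k x.
  have exP : exists k, enorm x < 2 ^+ k by exists k0.
  case: (ex_minnP exP) => -[|m] Pm mmin.
    exists 0%N; last exact: BP.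
    rewrite /c mul0n expr0 invr1 mul1r; apply: (@le_trans _ _ 1).
      rewrite invf_le1 ?exprn_gt0 ?enorm_gt0// exprn_ege1//.
      by have := enorm_ge0 x; have := expR_ge1Dx (1 : R); lra.
    by rewrite exprn_ege1// ler1n.
  exists m.+1; last exact: BP.
  have xm : 2 ^+ m <= enorm x.
    by rewrite leNgt; apply/negP => /mmin; rewrite ltnn.
  rewrite /c mulSn exprD invfM mulrAC mulVf ?expf_neq0// mul1r exprM.
  rewrite lef_pV2 ?posrE ?exprn_gt0 ?enorm_gt0//.
  apply: lerXn2r; rewrite ?nnegrE ?exprn_ge0 ?(ltW (enorm_gt0 x))//.
  by apply: (le_trans xm); rewrite lerDr expR_ge0.
apply: (@le_trans _ _ (c k * \1_(B k) x)%:E).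
  by rewrite lee_fin indicE mem_set ?mulr1.
apply: le_trans (nneseries_lim_ge k.+1 _); last first.
  by move=> j _ _; rewrite lee_fin mulr_ge0.
rewrite big_nat_recr//= leeDr// sume_ge0// => j _.
by rewrite lee_fin mulr_ge0.
Qed.

(** Two exponents at distance [O(1 / ln (e + |x|))] can be exchanged up to
    [tail_decay]. If [f] is at least this error, then
    [f `^ - `|u - v|] is bounded because [- ln f] is at most
    [n.+1 * ln (e + |x|)]. *)
Lemma powR_exchange C : 0 < C -> exists2 A, 1 <= A &
  forall (f u v : R) (x : V), 0 <= f <= 1 -> 1 <= u -> 1 <= v ->
  `|u - v| <= C / ln (expR 1 + enorm x) -> f `^ u <= A * f `^ v + tail_decay x.
Proof.
move=> C0; exists (expR (n.+1%:R * C)); first by rewrite -expR0 ler_expR mulr_ge0// ltW.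
move=> f u v x /andP[]; rewrite le_eqVlt => /predU1P[<- _ u1 v1 _|f0 f1 u1 v1 uv].
  rewrite powR0; last by rewrite gt_eqF//; lra.
  by rewrite addr_ge0 ?tail_decay_ge0// mulr_ge0 ?powR_ge0// expR_ge0.
have A0 : 0 <= expR (n.+1%:R * C) * f `^ v by rewrite mulr_ge0 ?powR_ge0 ?expR_ge0.
have [fh|hf] := leP f (tail_decay x).
  apply: (@le_trans _ _ f); last by lra.
  by apply: ge1r_powR => //; rewrite f0.
apply: (@le_trans _ _ (expR (n.+1%:R * C) * f `^ v)); last first.
  by rewrite lerDl tail_decay_ge0.
rewrite !powRE// -expRD ler_expR.
have y1 := ln_enorm_ge1 x; set y := ln _ in uv y1.
have lf : - (n.+1%:R * y) <= ln f.
  have -> : - (n.+1%:R * y) = ln (tail_decay x).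
    rewrite /tail_decay lnV ?posrE ?exprn_gt0 ?enorm_gt0//.
    by rewrite lnXn ?enorm_gt0// mulr_natl.
  rewrite ler_ln ?posrE ?invr_gt0 ?exprn_gt0 ?enorm_gt0//; exact: ltW.
have lf0 : ln f <= 0 by exact: ln_le0.
have : `|u - v| * - ln f <= C / y * (n.+1%:R * y).
  by apply: ler_pM => //; lra.
have -> : C / y * (n.+1%:R * y) = n.+1%:R * C.
  by field; rewrite gt_eqF// (lt_le_trans _ y1).
move=> h.
have : (v - u) * - ln f <= `|u - v| * - ln f.
  by apply: ler_wpM2r; [lra|rewrite distrC ler_norm].
lra.
Qed.

End key_estimate.

(** * The norm of the indicator function of a cube *)

Section measurable_power.
Local Open Scope classical_set_scope.
Local Open Scope ring_scope.

Lemma measurable_powR2 d (T : measurableType d) (R : realType) (f g : T -> R) :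
  measurable_fun setT f -> measurable_fun setT g ->
  measurable_fun setT (fun x => f x `^ g x).
Proof.
move=> mf mg; rewrite /powR; apply: measurable_fun_ifT.
- by apply: measurable_fun_eqr.
- rewrite (_ : (fun x => _) = \1_(g @^-1` [set 0])).
    by apply: measurable_indic; rewrite -[X in measurable X]setTI; exact: mg.
  by apply/funext => x; rewrite indicE; congr (nat_of_bool _)%:R; apply/idP/idP => [/eqP gx|/set_mem/eqP//]; exact/mem_set.
- apply: (measurableT_comp (@measurable_expR _)).
  exact: measurable_funM mg (measurableT_comp (@measurable_ln _) mf).
Qed.

End measurable_power.

Section norm_of_cube.
Local Open Scope classical_set_scope.
Local Open Scope ring_scope.
Context {R : realType} {n : nat}.
Local Notation V := (Rn R n).
Local Notation mu := (@lebesgueRn R n).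
Implicit Types (a : 'I_n -> R) (l : R) (A B D E : set V).

Lemma powR_ge1 (t u : R) : 1 <= t -> 0 <= u -> 1 <= t `^ u.
Proof. by move=> t1 u0; rewrite -(powRr0 t) ler_powR. Qed.

Variable r : V -> R.
Hypotheses (n_gt0 : (0 < n)%N) (r_LH : LH r) (r_ge1 : forall x, 1 <= r x).

Let mr : measurable_fun setT r. Proof. by case: r_LH. Qed.

Lemma modular_indic_le1 D (T : R) (g : V -> R) : measurable D -> 0 < T ->
  measurable_fun setT g -> (forall x, D x -> T^-1 `^ r x <= g x) ->
  (\int[mu]_(x in D) (g x)%:E <= 1)%E ->
  (modular (EFin \o r) (fun x => \1_D x / T)%R <= 1)%E.
Proof.
move=> mD T0 mg Tg g1; apply: le_trans g1; rewrite [leRHS]integral_mkcond.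
apply: le_integral_measurable measurableT _ _ _.
- apply/measurable_EFinP; apply: measurable_powR2 mr.
  apply: measurableT_comp (@normr_measurable _ _) _.
  by apply: measurable_funM; [exact: measurable_indic|exact: measurable_cst].
- apply/(measurable_restrictT _ mD); apply/measurable_EFinP.
  exact: measurable_funTS mg.
move=> x _ /=; rewrite patchE indicE; case: ifPn => [/set_mem Dx|_].
  by rewrite mul1r ger0_norm ?invr_ge0 ?(ltW T0)// lee_fin Tg.
by rewrite mul0r normr0 powR0// gt_eqF// (lt_le_trans _ (r_ge1 x)).
Qed.

Variable s : R.
Hypotheses (s1 : 1 < s) (sr : forall x, s <= r x).

(** Where [t] exceeds [M], the ratio [t / M] is at least 1 and its power is at
    least itself. *)
Lemma le_truncate (t M u : R) : 1 <= M -> 0 <= t -> s <= u ->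
  t <= M + M `^ (1 - s) * t `^ u.
Proof.
move=> M1 t0 su; have gt1_s := s1; have M0 : 0 < M by lra.
have p0 : 0 <= M `^ (1 - s) * t `^ u by rewrite mulr_ge0 ?powR_ge0.
have [tM|Mt] := leP t M; first by lra.
apply: (@le_trans _ _ (M `^ (1 - s) * t `^ u)); last by lra.
have tp : 0 < t by lra.
rewrite !powRE// -expRD -{1}(@lnK _ t) ?posrE// ler_expR.
have lM : 0 <= ln M by exact: ln_ge0.
have lt : ln M <= ln t by rewrite ler_ln// ltW.
have : 0 <= (s - 1) * (ln t - ln M) by apply: mulr_ge0; lra.
have : 0 <= (u - s) * ln t by apply: mulr_ge0; lra.
lra.
Qed.

Let point_itv (x y : V) a l : hcube a l x -> y = point_of a ->
  forall i, `|rn_coord x i - rn_coord y i| <= l.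
Proof.
move=> Qx -> i; rewrite rn_coord_point; have /andP[h1 h2] := Qx i.
by rewrite ler_norml; apply/andP; split; lra.
Qed.

(** With [T] essentially [|Q| ^ (1 / r x0)] for a vertex [x0], the oscillation
    bound gives [T `^ r x <= C * |Q|] at each point of [Q], and [le_truncate] applied
    to [T * f] concludes. *)
Lemma norm_small_cube : exists2 C, 0 <= C & forall a l, 0 < l <= 1 ->
  exists T, [/\ 0 < T, (modular (EFin \o r) (fun x => \1_(hcube a l) x / T)%R <= 1)%E &
  forall M f x, 1 <= M -> 0 <= f -> hcube a l x ->
   T * f <= M + M `^ (1 - s) * (C * l ^+ n * (f `^ r x + tail_decay x))].
Proof.
have [K K0 osc] := log_Holder_cube n_gt0 r_LH.
have [_ _ [q [Coo [_ Coo0 dec]]]] := r_LH.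
have bnd := decay_bounded dec Coo0.
exists (expR (n%:R * ((q + Coo + 1) * K))); first exact: expR_ge0.
move=> a l /andP[l0 l1].
pose x0 := point_of a; pose N : R := n%:R.
have N0 : 0 <= N by rewrite ler0n.
have lnl : ln l <= 0 by exact: ln_le0.
have r0 : 0 < r x0 by rewrite (lt_le_trans _ (r_ge1 x0)).
(* T is (e^(n K) |Q|)^(1/r x0), where |Q| = l^n. *)
pose tau := N * (K + ln l) / r x0.
have lnT : r x0 * tau = N * (K + ln l) by rewrite /tau mulrC divfK// gt_eqF.
have oscx x : hcube a l x -> `|(r x - r x0) * ln l| <= K.
  move=> Qx; rewrite normrM [`|ln l|]ler0_norm//; apply: osc; first by rewrite l0.
  exact: point_itv Qx erefl.
have T0 : 0 < expR tau by exact: expR_gt0.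
have lN : l ^+ n = expR (N * ln l).
  by rewrite -[in LHS](@lnK _ l) ?posrE// -expRM_natl.
exists (expR tau); split=> //.
  apply: (@modular_indic_le1 _ _ (cst (l ^- n))) => //; first exact: measurable_hcube.
    move=> x /oscx; rewrite ler_norml => /andP[h1 h2].
    rewrite powRE ?invr_gt0// lnV ?posrE// expRK /cst lN -expRN ler_expR.
    suff : r x0 * (N * ln l) <= r x0 * (r x * tau) by rewrite ler_pM2l//; lra.
    rewrite [leRHS]mulrCA lnT.
    have : 0 <= N * (r x * K - K + K + (r x - r x0) * ln l).
      rewrite mulr_ge0//; have := r_ge1 x => h.
      have : 0 <= (r x - 1) * K by apply: mulr_ge0; lra.
      lra.
    lra.
  rewrite (eq_integral (cst (l ^- n)%:E))// integral_cst; last exact: measurable_hcube.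
  rewrite -[X in (_ * X)%E]/(mu _) lebesgue_hcube//.
  by rewrite -EFinM mulVf// expf_neq0// gt_eqF.
move=> M f x M1 f0 Qx.
apply: (le_trans (le_truncate M1 _ (sr x))); first by rewrite mulr_ge0// ltW.
rewrite lerD2l ler_wpM2l ?powR_ge0//.
rewrite powRM ?(ltW T0)// mulrDr; apply: ler_wpDr.
  by rewrite mulr_ge0 ?tail_decay_ge0// mulr_ge0 ?expR_ge0// exprn_ge0// ltW.
rewrite ler_wpM2r ?powR_ge0// powRE// expRK lN -expRD ler_expR.
have /ler_normlP[h1 h2] := oscx x Qx.
have rxq : r x <= q + Coo by have /ler_normlP[] := bnd x; lra.
have r01 := r_ge1 x0.
suff : r x0 * (r x * tau) <= r x0 * (N * ((q + Coo + 1) * K) + N * ln l) by rewrite ler_pM2l.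
rewrite mulrCA lnT.
have -> : r x0 * (N * ((q + Coo + 1) * K) + N * ln l) =
  N * (r x0 * ((q + Coo + 1) * K) + r x0 * ln l) by ring.
rewrite mulrCA ler_wpM2l//.
have : (q + Coo + 1) * K <= r x0 * ((q + Coo + 1) * K).
  by rewrite ler_peMl//; apply: mulr_ge0; have := r_ge1 x; lra.
have : r x * K <= (q + Coo) * K by rewrite ler_wpM2r//; lra.
lra.
Qed.

(** Here [T] is of order [|Q| ^ (1 / q)], with [q] the exponent at infinity. As
    [T >= 1], the power [T `^ r x] can be much greater than [|Q|] where [r x > q];
    the truncation therefore uses the power [q] where [f <= 1], where it can be
    exchanged with [r x], and the smaller power [s] where [f > 1]. *)
Lemma norm_large_cube : exists2 C, 0 <= C & forall a l, 1 <= l ->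
  exists T, [/\ 0 < T, (modular (EFin \o r) (fun x => \1_(hcube a l) x / T)%R <= 1)%E &
  forall M f x, 1 <= M -> 0 <= f -> hcube a l x ->
   T * f <= M + M `^ (1 - s) * (C * l ^+ n * (f `^ r x + tail_decay x))].
Proof.
have [_ _ [q [Coo [_ Coo0 dec]]]] := r_LH; have gt1_s := s1.
have sq : s <= q.
  exact: (limit_exponent_ge n_gt0 r_LH (aeW _ sr) Coo0 dec).
have q0 : 0 < q by lra.
have q1 : 1 <= q by lra.
have [A A1 exch] := @powR_exchange R n Coo Coo0.
have [H H0 intH] := @integral_tail_decay R n.
pose C0 := A + H; have C01 : 1 <= C0 by rewrite /C0; lra.
have C0q : 1 <= C0 `^ q by apply: powR_ge1; lra.
exists (C0 `^ q * A); first by rewrite mulr_ge0//; lra.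
move=> a l l1; have l0 : 0 < l by lra.
have ln1 : 1 <= l ^+ n by rewrite exprn_ege1.
pose T1 := (l ^+ n) `^ q^-1.
have T11 : 1 <= T1.
  by apply: powR_ge1 => //; rewrite invr_ge0; lra.
have T1q : T1 `^ q = l ^+ n.
  by rewrite /T1 -powRrM mulVf ?gt_eqF// powRr1; lra.
pose T := C0 * T1.
have T_ge1 : 1 <= T by rewrite -[leLHS]mulr1 ler_pM.
have T0 : 0 < T by lra.
have Tq : T `^ q = C0 `^ q * l ^+ n by rewrite powRM ?T1q//; lra.
exists T; split=> //.
  have mg : measurable_fun setT (fun x : V => C0^-1 * (A * l ^- n + tail_decay x)).
    apply: measurable_funM; first exact: measurable_cst.
    exact: measurable_funD (measurable_cst _) measurable_tail_decay.
  apply: (modular_indic_le1 (measurable_hcube a l) T0 mg).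
  - move=> x Qx; rewrite /T invfM powRM ?invr_ge0; [|lra|lra].
    apply: ler_pM; rewrite ?powR_ge0//.
      have C0i : 0 < C0^-1 <= 1 by rewrite invr_gt0 invf_le1//; lra.
      exact: (ge1r_powR C0i (r_ge1 x)).
    have -> : l ^- n = T1^-1 `^ q.
      rewrite -T1q -(@powR_inv1 _ (T1 `^ q)) ?powR_ge0// -(@powR_inv1 _ T1); last lra.
      exact: powRAC.
    apply: exch => //.
      by rewrite invr_ge0 invf_le1//; lra.
  - have mQ := @measurable_hcube R n a l.
    have mt : measurable_fun (hcube a l) (EFin \o @tail_decay R n).
      by apply/measurable_EFinP; exact: measurable_funTS (@measurable_tail_decay R n).
    have c0 : 0 <= A / l ^+ n by rewrite mulr_ge0 ?invr_ge0 ?exprn_ge0//; lra.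
    have I1 : (\int[mu]_(x in hcube a l) (A / l ^+ n)%:E)%E = A%:E.
      rewrite (eq_integral (cst (A / l ^+ n)%:E))// integral_cst//.
      rewrite -[X in (_ * X)%E]/(mu _) lebesgue_hcube//.
      by rewrite -EFinM divfK// gt_eqF//; lra.
    have I2 : (\int[mu]_(x in hcube a l) (A / l ^+ n + tail_decay x)%:E <= (A + H)%:E)%E.
      rewrite (eq_integral (fun x => (A / l ^+ n)%:E + (tail_decay x)%:E)%E)//.
      have p1 x : hcube a l x -> (0 <= (A / l ^+ n)%:E)%E by rewrite lee_fin.
      have p2 x : hcube a l x -> (0 <= (tail_decay x)%:E)%E.
        by rewrite lee_fin tail_decay_ge0.
      rewrite (ge0_integralD mu mQ p1 (measurable_cst _) p2 mt).
      by rewrite I1 EFinD leeD2l// intH.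
    have mAt : measurable_fun (hcube a l) (fun x => (A / l ^+ n + tail_decay x)%:E).
      apply/measurable_EFinP; apply: measurable_funD; first exact: measurable_cst.
      exact: measurable_funTS (@measurable_tail_decay R n).
    have At0 x : hcube a l x -> (0 <= (A / l ^+ n + tail_decay x)%:E)%E.
      by move=> _; rewrite lee_fin addr_ge0 ?tail_decay_ge0.
    have C0i : 0 <= C0^-1 by rewrite invr_ge0; lra.
    rewrite (eq_integral (fun x => C0^-1%:E * (A / l ^+ n + tail_decay x)%:E)%E)//.
    rewrite (ge0_integralZl_EFin _ mQ At0 mAt C0i).
    apply: (@le_trans _ _ (C0^-1%:E * (A + H)%:E)%E); first exact: lee_wpmul2l.
    by rewrite -EFinM lee_fin mulVf// gt_eqF//; lra.
move=> M f x M1 f0 Qx.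
have Tf0 : 0 <= T * f by rewrite mulr_ge0//; lra.
have h0 := tail_decay_ge0 x; have fr0 := powR_ge0 f (r x).
have Ms0 : 0 <= M `^ (1 - s) by exact: powR_ge0.
have [f1|f1] := leP f 1.
  have Tfq : T * f <= M + M `^ (1 - s) * (T * f) `^ q by exact: le_truncate.
  apply: (le_trans Tfq); rewrite lerD2l ler_wpM2l//.
  rewrite powRM//; last lra.
  rewrite Tq.
  have : f `^ q <= A * (f `^ r x + tail_decay x).
    have : f `^ q <= A * f `^ r x + tail_decay x.
      apply: exch => //; first by rewrite f0.
      by rewrite distrC.
    have : tail_decay x <= A * tail_decay x by rewrite ler_peMl.
    lra.
  move=> h; rewrite -[leRHS]mulrA.
  have -> : C0 `^ q * A * (l ^+ n * (f `^ r x + tail_decay x)) =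
    C0 `^ q * l ^+ n * (A * (f `^ r x + tail_decay x)) by ring.
  by rewrite ler_wpM2l// mulr_ge0//; lra.
have Tfs : T * f <= M + M `^ (1 - s) * (T * f) `^ s by exact: le_truncate.
apply: (le_trans Tfs); rewrite lerD2l ler_wpM2l//.
rewrite powRM//; last lra.
apply: (@le_trans _ _ (T `^ q * f `^ r x)).
  apply: ler_pM; rewrite ?powR_ge0//; apply: ler_powR => //; lra.
rewrite Tq.
have -> : C0 `^ q * A * l ^+ n * (f `^ r x + tail_decay x) =
  C0 `^ q * l ^+ n * (A * (f `^ r x + tail_decay x)) by ring.
apply: ler_wpM2l; first by rewrite mulr_ge0//; lra.
have : 1 * (f `^ r x + tail_decay x) <= A * (f `^ r x + tail_decay x).
  by rewrite ler_wpM2r//; lra.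
lra.
Qed.

End norm_of_cube.

(** * Passing from cubes to half-open cubes *)

Section cube_transfer.
Local Open Scope classical_set_scope.
Local Open Scope ring_scope.
Context {R : realType} {n : nat}.
Local Notation V := (Rn R n).
Local Notation mu := (@lebesgueRn R n).
Implicit Types (a : 'I_n -> R) (l : R) (Q A B D E : set V).

(** Both sets lie between the open and the closed cube, which have the same
    measure. *)
Lemma cube_ae_hcube Q : cube Q -> exists a l, [/\ 0 < l, measurable Q,
  mu Q = (l ^+ n)%:E & {ae mu, forall x, Q x <-> hcube a l x}].
Proof.
move=> [a [l [bl [br [l0 ->]]]]]; exists a, l.
pose I b c : set V := [set x | forall i,
  rn_coord x i \in Interval (BSide (b i) (a i)) (BSide (c i) (a i + l))].
have mI b c : measurable (I b c).
  rewrite (_ : I b c = box (fun i => [set` Interval (BSide (b i) (a i)) (BSide (c i) (a i + l))]))//.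
  apply: measurable_Rn_borel; apply: measurable_box => i; exact: measurable_itv.
have muI b c : mu (I b c) = (l ^+ n)%:E by exact: lebesgueRn_cube.
split=> //; [exact: mI|exact: muI|].
pose F := I (fun=> true) (fun=> false); pose O := I (fun=> false) (fun=> true).
have sub b c : O `<=` I b c /\ I b c `<=` F.
  split=> x xI i; move: (xI i); rewrite !in_itv/=; case: (b i); case: (c i) => //= /andP[h1 h2];
    by apply/andP; split=> //; exact: ltW.
have FO : mu (F `\` O) = 0%E.
  have : (mu F = mu O + mu (F `\` O))%E.
    rewrite -[in LHS](setUIDK F O) measureU.
    - by rewrite (setIidr ((sub _ _).1)).
    - exact: measurableI (mI _ _) (mI _ _).
    - exact: measurableD (mI _ _) (mI _ _).
    - by rewrite -subset0 => x [[_ ?] [_ ]].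
  rewrite !muI => /eqP.
  have : (0 <= mu (F `\` O))%E by exact: measure_ge0.
  case: (mu (F `\` O)) => // t _; rewrite -EFinD eqe => /eqP h.
  by congr EFin; lra.
exists (F `\` O); split=> //; first exact: measurableD (mI _ _) (mI _ _).
have [OI IF] := sub bl br.
have Oh : O `<=` hcube a l by rewrite hcube_itv; exact: (sub _ _).1.
have hF : hcube a l `<=` F by rewrite hcube_itv; exact: (sub _ _).2.
move=> x /= nx; split.
  apply: contrapT => nF; apply: nx; split=> h; exfalso; apply: nF.
    exact: IF.
  exact: hF.
by move=> Ox; apply: nx; split=> _; [exact: Oh|exact: OI].
Qed.

Variable r : V -> R.
Hypotheses (mr : measurable_fun setT r).

Lemma measurable_modular_fun (f : V -> R) : measurable_fun setT f ->
  measurable_fun setT (fun x => vpow `|f x| ((EFin \o r) x)).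
Proof.
move=> mf; apply/measurable_EFinP; apply: (measurable_powR2 _ mr).
exact: measurableT_comp (@normr_measurable _ _) mf.
Qed.

Lemma vLnorm_ae (f g : V -> R) : measurable_fun setT f -> measurable_fun setT g ->
  {ae mu, forall x, f x = g x} -> vLnorm (EFin \o r) f = vLnorm (EFin \o r) g.
Proof.
move=> mf mg fg.
pose S (m : R -> \bar R) := ereal_inf [set t%:E | t in [set t : R | 0 < t /\ (m t <= 1)%E]].
suff h : (fun t => modular (EFin \o r) (fun x => f x / t)) =
         (fun t => modular (EFin \o r) (fun x => g x / t)) by exact: (congr1 S h).
apply/funext => t; apply: ae_eq_integral measurableT _ _ _.
- apply: measurable_modular_fun; exact: measurable_funM mf (measurable_cst _).
- apply: measurable_modular_fun; exact: measurable_funM mg (measurable_cst _).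
- by apply: filterS fg => x fgx _ /=; rewrite fgx.
Qed.

Lemma integral_ae_set A B (f : V -> \bar R) : measurable A -> measurable B ->
  measurable_fun setT f -> {ae mu, forall x, A x <-> B x} ->
  (\int[mu]_(x in A) f x = \int[mu]_(x in B) f x)%E.
Proof.
move=> mA mB mf AB; rewrite integral_mkcond [RHS]integral_mkcond.
apply: ae_eq_integral measurableT _ _ _.
- exact/(measurable_restrictT _ mA)/measurable_funTS.
- exact/(measurable_restrictT _ mB)/measurable_funTS.
apply: filterS AB => x AB _; rewrite !patchE; congr (if _ then _ else _).
by apply/idP/idP => /set_mem/AB/mem_set.
Qed.

End cube_transfer.

(** * Integrals of functions in the variable Lebesgue space *)

Section affine_bound.
Local Open Scope classical_set_scope.
Local Open Scope ring_scope.

Lemma integral_affine_bound d (T : measurableType d) (R : realType)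
    (mu : {measure set T -> \bar R}) (D : set T) (f g h : T -> R)
    (M B v P H : R) :
  measurable D -> measurable_fun setT f -> measurable_fun setT g ->
  measurable_fun setT h -> (forall x, 0 <= g x) -> (forall x, 0 <= h x) ->
  0 <= M -> 0 <= B -> (forall x, D x -> f x <= M + B * (g x + h x)) ->
  mu D = v%:E -> (\int[mu]_(x in D) (g x)%:E <= P%:E)%E ->
  (\int[mu]_(x in D) (h x)%:E <= H%:E)%E ->
  (\int[mu]_(x in D) (f x)%:E <= (M * v + B * (P + H))%:E)%E.
Proof.
move=> mD mf mg mh g0 h0 M0 B0 fgh muD gP hH.
have mE (k : T -> R) : measurable_fun setT k -> measurable_fun D (EFin \o k).
  by move=> mk; apply/measurable_EFinP; exact: measurable_funTS.
have mgh : measurable_fun setT (fun x => g x + h x) by exact: measurable_funD.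
have mBgh : measurable_fun D (fun x => B%:E * ((g x)%:E + (h x)%:E))%E.
  exact: (mE _ (measurable_funM (measurable_cst B) mgh)).
have mM : measurable_fun D (fun=> M%:E) by exact: measurable_cst.
have g0' x : D x -> (0 <= (g x)%:E)%E by rewrite lee_fin.
have h0' x : D x -> (0 <= (h x)%:E)%E by rewrite lee_fin.
have gh0 x : D x -> (0 <= (g x)%:E + (h x)%:E)%E by move=> Dx; rewrite adde_ge0 ?g0' ?h0'.
have M0' x : D x -> (0 <= M%:E)%E by rewrite lee_fin.
have Bgh0 x : D x -> (0 <= B%:E * ((g x)%:E + (h x)%:E))%E.
  by move=> Dx; rewrite mule_ge0 ?gh0// lee_fin.
have fle x : D x -> ((f x)%:E <= M%:E + B%:E * ((g x)%:E + (h x)%:E))%E.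
  by move=> Dx; have := fgh x Dx; rewrite -lee_fin EFinD EFinM EFinD.
have mR : measurable_fun D (fun x => M%:E + B%:E * ((g x)%:E + (h x)%:E))%E.
  exact: emeasurable_funD mM mBgh.
apply: le_trans (le_integral_measurable mu mD (mE _ mf) mR fle) _.
rewrite (ge0_integralD mu mD M0' mM Bgh0 mBgh) integral_cst//.
rewrite (ge0_integralZl_EFin mu mD gh0 (mE _ mgh) B0).
rewrite (ge0_integralD mu mD g0' (mE _ mg) h0' (mE _ mh)).
rewrite EFinD EFinM -muD leeD2l// EFinM lee_wpmul2l ?lee_fin// EFinD.
exact: leeD.
Qed.

End affine_bound.

Section extended_product.
Local Open Scope ring_scope.
Context {R : realType}.
Implicit Types x y z : \bar R.

Lemma mulI_leP x y (K : R) : (mulI x y <= K%:E)%E ->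
  [/\ x != +oo, y != +oo & x * y <= K%:E]%E.
Proof. by rewrite /mulI; case: ifPn => // /norP[-> ->]. Qed.

Lemma mulI_ge0 x y : (0 <= x -> 0 <= y -> 0 <= mulI x y)%E.
Proof. by rewrite /mulI => x0 y0; case: ifP => _; [exact: leey|exact: mule_ge0]. Qed.

Lemma le_mulI x y z : (0 <= x -> y <= z -> mulI x y <= mulI x z)%E.
Proof.
rewrite /mulI => x0 yz; case: (x == +oo%E) => //=.
case: (eqVneq z +oo%E) => [_|zoo]; first by rewrite leey.
case: (eqVneq y +oo%E) => [yoo|_]; last exact: lee_wpmul2l.
by move: yz zoo; rewrite yoo leye_eq => /eqP ->.
Qed.

End extended_product.

Section weights_on_cubes.
Local Open Scope classical_set_scope.
Local Open Scope ring_scope.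
Context {R : realType} {n : nat}.
Local Notation V := (Rn R n).
Local Notation mu := (@lebesgueRn R n).
Implicit Types (a : 'I_n -> R) (l : R) (Q A B D E : set V).

Variable r : V -> R.
Hypotheses (n_gt0 : (0 < n)%N) (r_LH : LH r) (r_ge1 : forall x, 1 <= r x).
Variable s : R.
Hypotheses (s1 : 1 < s) (sr : forall x, s <= r x).
Let mr : measurable_fun setT r. Proof. by case: r_LH. Qed.
Local Notation p := (EFin \o r).

(** The constant [C] does not depend on the cube, and the factor [M `^ (1 - s)] tends
    to 0 as [M] grows because [s > 1]: functions of norm 1 are equi-integrable in
    the normalization given by [T]. *)
Lemma norm_cube : exists2 C, 0 <= C & forall a l, 0 < l ->
  exists T, [/\ 0 < T, (modular p (fun x => \1_(hcube a l) x / T)%R <= 1)%E &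
  forall M f x, 1 <= M -> 0 <= f -> hcube a l x ->
   T * f <= M + M `^ (1 - s) * (C * l ^+ n * (f `^ r x + tail_decay x))].
Proof.
have [C1 C10 h1] := norm_small_cube n_gt0 r_LH r_ge1 s1 sr.
have [C2 C20 h2] := norm_large_cube n_gt0 r_LH r_ge1 s1 sr.
exists (C1 + C2); first exact: addr_ge0.
have mono (M b c1 c2 : R) : 0 <= b -> c1 <= c2 ->
    M + M `^ (1 - s) * (c1 * b) <= M + M `^ (1 - s) * (c2 * b).
  by move=> b0 c12; rewrite lerD2l ler_wpM2l ?powR_ge0// ler_wpM2r.
have b0 l f x : 0 < l -> 0 <= l ^+ n * (f `^ r x + tail_decay x).
  by move=> l0; rewrite mulr_ge0 ?exprn_ge0 ?(ltW l0)// addr_ge0 ?powR_ge0 ?tail_decay_ge0.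
move=> a l l0; have [l1|l1] := leP l 1.
  have [|T [T0 hT h]] := h1 a l; first by rewrite l0.
  exists T; split=> // M f x M1 f0 Qx; apply: (le_trans (h M f x M1 f0 Qx)).
  by rewrite -![_ * l ^+ n * _]mulrA mono ?b0// lerDl.
have [T [T0 hT h]] := h2 a l (ltW l1).
exists T; split=> // M f x M1 f0 Qx; apply: (le_trans (h M f x M1 f0 Qx)).
by rewrite -![_ * l ^+ n * _]mulrA mono ?b0// lerDr.
Qed.

Lemma vLnorm_ge0 (f : V -> R) : (0 <= vLnorm p f)%E.
Proof. by apply: le_ereal_inf_tmp => _ [t [t0 _] <-]; rewrite lee_fin ltW. Qed.

Lemma vLnorm_le (f : V -> R) (t : R) : 0 < t ->
  (modular p (fun x => f x / t)%R <= 1)%E -> (vLnorm p f <= t%:E)%E.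
Proof. by move=> t0 ft; apply: ereal_inf_lbound; exists t. Qed.

Lemma vLnorm_lt (f : V -> R) (c : \bar R) : (vLnorm p f < c)%E ->
  exists t : R, [/\ 0 < t, (t%:E < c)%E & (modular p (fun x => f x / t)%R <= 1)%E].
Proof. by move=> /ereal_inf_lt[_ [t [t0 ft] <-] tc]; exists t. Qed.

(** [norm_cube] integrated over a subset of the cube for [f = w / t]. *)
Lemma truncated_integral (w : V -> R) : measurable_fun setT w -> (forall x, 0 <= w x) ->
  exists2 C, 0 <= C & forall a l, 0 < l -> exists T, [/\ 0 < T,
  (vLnorm p \1_(hcube a l) <= T%:E)%E &
  forall t M A, 0 < t -> (modular p (fun x => w x * \1_(hcube a l) x / t)%R <= 1)%E ->
   1 <= M -> measurable A -> A `<=` hcube a l ->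
   (\int[mu]_(x in A) (w x)%:E <= (t / T * (M * vol A + M `^ (1 - s) * (C * l ^+ n)))%:E)%E].
Proof.
move=> mw w0; have [C C0 hC] := norm_cube.
have [H H0 intH] := @integral_tail_decay R n.
exists (C * (1 + H)); first by rewrite mulr_ge0// addr_ge0.
move=> a l l0; have [T [T0 hT h]] := hC a l l0.
exists T; split=> //; first exact: vLnorm_le.
move=> t M A t0 wt M1 mA AQ.
have M0 : 0 <= M := le_trans ler01 M1.
have mf : measurable_fun setT (fun x => w x / t) by exact: measurable_funM mw (measurable_cst _).
have mTf : measurable_fun setT (fun x => T * (w x / t)) by exact: measurable_funM (measurable_cst _) mf.
have mg := measurable_powR2 mf mr.
have f0 x : 0 <= w x / t by rewrite divr_ge0// ltW.
pose B := M `^ (1 - s) * (C * l ^+ n).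
have B0 : 0 <= B by rewrite mulr_ge0 ?powR_ge0// mulr_ge0// exprn_ge0// ltW.
have m1 : measurable_fun setT (\1_(hcube a l) : V -> R).
  by apply: measurable_indic; exact: measurable_hcube.
have mw1 : measurable_fun setT (fun x => w x * \1_(hcube a l) x / t).
  exact: measurable_funM (measurable_funM mw m1) (measurable_cst _).
have gP : (\int[mu]_(x in A) ((w x / t) `^ r x)%:E <= 1)%E.
  apply: le_trans wt; rewrite integral_mkcond.
  apply: le_integral_measurable measurableT _ _ _.
  - exact/(measurable_restrictT _ mA)/measurable_EFinP/measurable_funTS/mg.
  - exact: (measurable_modular_fun mr mw1).
  move=> x _; rewrite patchE; case: ifPn => [/set_mem Ax|_].
    rewrite /= indicE mem_set; last exact: AQ.
    by rewrite mulr1 ger0_norm.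
  by rewrite /= lee_fin powR_ge0.
have muA : mu A = (vol A)%:E by rewrite -(setIidr AQ) lebesgue_vol.
have bound : (\int[mu]_(x in A) (T * (w x / t))%:E <= (M * vol A + B * (1 + H))%:E)%E.
  apply: (integral_affine_bound mA mTf mg (@measurable_tail_decay R n) _ _ M0 B0 _ muA gP (intH _ mA)).
  - by move=> x; exact: powR_ge0.
  - exact: tail_decay_ge0.
  - by move=> x Ax; rewrite /B -mulrA; apply: h => //; exact: AQ.
have -> : M * vol A + M `^ (1 - s) * (C * (1 + H) * l ^+ n) = M * vol A + B * (1 + H).
  by rewrite /B; ring.
have tT : 0 <= t / T by rewrite divr_ge0// ltW.
have mTfA : measurable_fun A (fun x => (T * (w x / t))%:E).
  by apply/measurable_EFinP; exact: measurable_funTS mTf.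
have Tf0 x : A x -> (0 <= (T * (w x / t))%:E)%E.
  by move=> _; rewrite lee_fin mulr_ge0 ?f0// ltW.
rewrite (eq_integral (fun x => (t / T)%:E * (T * (w x / t))%:E)%E); last first.
  by move=> x _; rewrite -EFinM; congr EFin; field; rewrite !gt_eqF.
by rewrite (ge0_integralZl_EFin _ mA Tf0 mTfA tT) [leRHS]EFinM lee_wpmul2l.
Qed.

Lemma loc_weight_of_norm (w : V -> R) : measurable_fun setT w -> (forall x, 0 <= w x) ->
  (forall a l, 0 < l -> (vLnorm p (fun x => w x * \1_(hcube a l) x)%R < +oo)%E) ->
  loc_weight w.
Proof.
move=> mw w0 fin; split=> // a l l0; have [C C0 hC] := truncated_integral mw w0.
have [T [T0 hT h]] := hC a l l0.
have [t [t0 _ wt]] := vLnorm_lt (fin a l l0).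
apply: le_lt_trans (h t 1 _ t0 wt _ (measurable_hcube a l) (@subset_refl _ _)) _ => //.
exact: ltry.
Qed.

Lemma mass_gt0 (w : V -> R) a l : loc_weight w -> {ae mu, forall x, 0 < w x} ->
  0 < l -> 0 < mass w (hcube a l).
Proof.
move=> ww wpos l0; rewrite lt_def (mass_ge0 ww) andbT; apply/eqP => m0.
have [mw w0 _] := ww; have mQ := @measurable_hcube R n a l.
have : (\int[mu]_(x in hcube a l) `|(w x)%:E| = 0)%E.
  under eq_integral do rewrite gee0_abs ?lee_fin//.
  by rewrite (mass_fin_sub ww l0 mQ (@subset_refl _ _)) m0.
have mwQ : measurable_fun (hcube a l) (EFin \o w).
  by apply/measurable_EFinP; exact: measurable_funTS mw.
move=> /(ae_eq_integral_abs _ mQ mwQ) wz.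
have [x Qx [wx /(_ Qx)/= [wx0]]] := ae_hcube_nonempty a l0 (filterI wpos wz).
by move: wx; rewrite wx0 ltxx.
Qed.

End weights_on_cubes.

(** * The two conditions on a half-open cube *)

Section real_bounds.
Local Open Scope ring_scope.
Context {R : realType}.

Lemma small_portion_bound (K' T m v vA M C q t : R) :
  1 <= K' -> 0 < T -> 0 < m ->
  0 < v -> 0 <= vA -> vA <= (8 * K' * M)^-1 * v -> 1 <= M -> 0 <= C -> 0 <= q ->
  q * (2 * K' * C) <= 4^-1 -> t <= 2 * K' * T * m ->
  t / T * (M * vA + q * (C * v)) <= m * v / 2.
Proof.
move=> K1 T0 m0 v0 vA0 vAv M1 C0 q0 qC tl.
have K0 : 0 < K' by lra.
have M0 : 0 < M by lra.
have X0 : 0 <= M * vA + q * (C * v).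
  by rewrite addr_ge0// mulr_ge0// ?(ltW M0)// mulr_ge0// ltW.
have tT : t / T <= 2 * K' * m by rewrite ler_pdivrMr//; lra.
apply: (le_trans (ler_wpM2r X0 tT)).
have -> : 2 * K' * m * (M * vA + q * (C * v)) =
  m * (2 * K' * M * vA + q * (2 * K' * C) * v) by ring.
rewrite -[leRHS]mulrA ler_wpM2l ?(ltW m0)//.
have h1 : 2 * K' * M * vA <= 2 * K' * M * ((8 * K' * M)^-1 * v).
  by apply: ler_wpM2l => //; rewrite !mulr_ge0 ?(ltW K0) ?(ltW M0).
have h2 : 2 * K' * M * ((8 * K' * M)^-1 * v) = v / 4.
  by field; rewrite !gt_eqF.
have h3 : q * (2 * K' * C) * v <= 4^-1 * v by rewrite ler_wpM2r// ltW.
lra.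
Qed.

Lemma lt_double_bound (t T m K K' lam : R) : 0 < t -> t <= T -> 0 < m ->
  K <= K' -> 1 <= K' -> t^-1 * lam * m^-1 <= K -> lam < 2 * K' * T * m.
Proof.
move=> t0 tT m0 KK' K'1; rewrite ler_pdivrMr// mulrC ler_pdivrMr// => h.
have K'0 : 0 < K' by lra.
have h1 : 0 < K' * T * m by rewrite mulr_gt0// mulr_gt0//; lra.
have h2 : K' * t * m <= K' * T * m by rewrite ler_wpM2r ?(ltW m0)// ler_wpM2l ?(ltW K'0).
have h3 : K * m * t <= K' * m * t.
  by rewrite ler_wpM2r ?(ltW t0)// ler_wpM2r ?(ltW m0).
lra.
Qed.

Lemma expr_scaleK (l c : R) k : 0 < l -> l ^- k * (c * l ^+ k) = c.
Proof. by move=> l0; rewrite mulrC mulfK// expf_neq0// gt_eqF. Qed.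

End real_bounds.

Section weight_classes.
Local Open Scope classical_set_scope.
Local Open Scope ring_scope.
Context {R : realType} {n : nat}.
Local Notation V := (Rn R n).
Local Notation mu := (@lebesgueRn R n).
Implicit Types (a : 'I_n -> R) (l : R) (Q A B D E : set V) (w : V -> R).

Variable r : V -> R.
Hypotheses (n_gt0 : (0 < n)%N) (r_LH : LH r) (r_ge1 : forall x, 1 <= r x).
Variable s : R.
Hypotheses (s1 : 1 < s) (sr : forall x, s <= r x).
Let mr : measurable_fun setT r. Proof. by case: r_LH. Qed.
Local Notation p := (EFin \o r).

(** The factor shared by the two conditions. *)
Definition norm_ratio w Q : \bar R :=
  mulI (vLnorm p \1_Q)^-1%E (vLnorm p (fun x => w x * \1_Q x)%R).

Definition log_average w Q : \bar R := average Q (fun y => lne (w y)%:E^-1)%E.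

Definition weight_average w Q : \bar R := average Q (fun x => (w x)%:E).

Lemma cube_data w Q : measurable_fun setT w -> (forall x, 0 <= w x) -> cube Q ->
  exists a l, [/\ 0 < l, norm_ratio w Q = norm_ratio w (hcube a l),
    log_average w Q = log_average w (hcube a l) &
    weight_average w Q = weight_average w (hcube a l)].
Proof.
move=> mw w0 /cube_ae_hcube[a [l [l0 mQ muQ Qae]]]; exists a, l.
have mh := @measurable_hcube R n a l.
have m1 D : measurable D -> measurable_fun setT (\1_D : V -> R).
  by move=> mD; exact: measurable_indic.
have e1 : {ae mu, forall x, \1_Q x = \1_(hcube a l) x :> R}.
  apply: filterS Qae => x h; rewrite !indicE; congr (nat_of_bool _)%:R.
  by apply/idP/idP => /set_mem/h/mem_set.
have n1 : vLnorm p \1_Q = vLnorm p \1_(hcube a l).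
  exact: (vLnorm_ae mr (m1 _ mQ) (m1 _ mh) e1).
have n2 : vLnorm p (fun x => w x * \1_Q x)%R = vLnorm p (fun x => w x * \1_(hcube a l) x)%R.
  apply: (vLnorm_ae mr (measurable_funM mw (m1 _ mQ)) (measurable_funM mw (m1 _ mh))).
  by apply: filterS e1 => x /= ->.
have av (f : V -> \bar R) : measurable_fun setT f -> average Q f = average (hcube a l) f.
  by move=> mf; rewrite /average (integral_ae_set mQ mh mf Qae) muQ lebesgue_hcube.
have mE : measurable_fun setT (EFin \o w) by apply/measurable_EFinP.
split; first exact: l0.
- by rewrite /norm_ratio n1 n2.
- exact: (av _ (measurable_log_inv mw w0)).
- exact: (av _ mE).
Qed.

Lemma averageE a l (f : V -> \bar R) : 0 < l ->
  average (hcube a l) f = ((l ^- n)%:E * \int[mu]_(x in hcube a l) f x)%E.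
Proof.
move=> l0; rewrite /average lebesgue_hcube// inver gt_eqF//.
exact: exprn_gt0.
Qed.

Lemma weight_averageE w a l : loc_weight w -> 0 < l ->
  weight_average w (hcube a l) = (mass w (hcube a l) / l ^+ n)%:E.
Proof.
move=> ww l0; rewrite /weight_average averageE//.
by rewrite (mass_fin_sub ww l0 (measurable_hcube a l) (@subset_refl _ _)) -EFinM mulrC.
Qed.

Lemma norm_ratio_ge0 w Q : (0 <= norm_ratio w Q)%E.
Proof. by apply: mulI_ge0; rewrite ?inve_ge0 vLnorm_ge0. Qed.

Lemma norm_ratio_fin w Q : norm_ratio w Q != +oo%E ->
  [/\ vLnorm p \1_Q != 0%E, (vLnorm p (fun x => w x * \1_Q x)%R < +oo)%E &
   norm_ratio w Q = ((vLnorm p \1_Q)^-1 * vLnorm p (fun x => w x * \1_Q x)%R)%E].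
Proof.
rewrite /norm_ratio /mulI; case: ifPn; first by rewrite eqxx.
move=> /norP[h1 h2] _; split=> //; last by rewrite ltey.
by apply: contra h1 => /eqP ->; rewrite inver eqxx.
Qed.

(** Jensen's inequality, from the tangent line of the logarithm at the average
    [m] of [w]. *)
Lemma weight_average_le w a l : loc_weight w -> {ae mu, forall x, 0 < w x} -> 0 < l ->
  ((weight_average w (hcube a l))^-1 <= expeR (log_average w (hcube a l)))%E.
Proof.
move=> ww wpos l0; rewrite weight_averageE//; have [mw w0 _] := ww.
have mQ := @measurable_hcube R n a l.
have M0 := mass_gt0 a ww wpos l0.
have ln0 : 0 < l ^+ n by exact: exprn_gt0.
set m := _ / _; have m0 : 0 < m by rewrite divr_gt0.
rewrite inver gt_eqF//.
have -> : (m^-1%:E = expeR (- ln m)%:E)%E by rewrite /= expRN lnK.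
rewrite lee_expeR /log_average averageE//.
(* ln t <= ln m + (t / m - 1) at t = w x *)
have key x : ((1 - ln m)%:E + (- m^-1)%:E * (w x)%:E <= lne (w x)%:E^-1)%E.
  rewrite lne_inver//; case: eqP => [_|/eqP wx]; first exact: leey.
  rewrite -EFinM -EFinD lee_fin.
  have wx0 : 0 < w x by rewrite lt_def wx w0.
  have : ln (w x / m) <= w x / m - 1.
    have := expR_ge1Dx (ln (w x / m)); rewrite lnK ?posrE ?divr_gt0//; lra.
  by rewrite ln_div ?posrE//; lra.
have iw : mu.-integrable (hcube a l) (EFin \o w).
  apply/integrableP; split; first by apply/measurable_EFinP; exact: measurable_funTS mw.
  under eq_integral do rewrite /= ger0_norm//.
  by rewrite (mass_fin_sub ww l0 mQ (@subset_refl _ _)) ltry.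
have ic : mu.-integrable (hcube a l) (cst (1 - ln m)%:E).
  apply/integrableP; split; first exact: measurable_cst.
  rewrite integral_cst// -[X in (_ * X)%E]/(mu _) lebesgue_hcube//.
  by rewrite -EFinM ltry.
have ikw := integrableZl mQ (- m^-1) iw.
have I : (\int[mu]_(x in hcube a l) ((1 - ln m)%:E + (- m^-1)%:E * (w x)%:E) =
    (- ln m * l ^+ n)%:E)%E.
  rewrite (integralD mQ ic ikw) (integralZl mQ iw) integral_cst//.
  rewrite -[X in (_ * X + _)%E]/(mu _) lebesgue_hcube//.
  rewrite (mass_fin_sub ww l0 mQ (@subset_refl _ _)) -!EFinM -EFinD; congr EFin.
  have -> : mass w (hcube a l) = m * l ^+ n by rewrite /m divfK ?gt_eqF.
  by field; rewrite gt_eqF.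
have le : (\int[mu]_(x in hcube a l) ((1 - ln m)%:E + (- m^-1)%:E * (w x)%:E) <=
    \int[mu]_(x in hcube a l) lne (w x)%:E^-1)%E.
  have [mG _] := integrableP _ _ _ (integrableD mQ ic ikw).
  have mF := measurable_funTS (D := hcube a l) (measurable_log_inv mw w0).
  exact: (le_integral_measurable mu mQ mG mF (fun x _ => key x)).
have -> : ((- ln m)%:E = (l ^- n)%:E * (- ln m * l ^+ n)%:E)%E.
  by rewrite -EFinM mulrC mulfK// gt_eqF.
by rewrite -I lee_wpmul2l// lee_fin invr_ge0 ltW.
Qed.

(** The condition bounds the norm of [w] on [Q] by [2 * K' * T * m], with [m] the
    average of [w]; so by [truncated_integral] the mass of [A] is at most
    [2 * K' * m * (M * vol A + M `^ (1 - s) * C * |Q|)]. First [M] is chosen so that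
    the second term is at most a quarter of the mass of [Q], and then [alpha] so
    that the first one is, too. *)
Lemma star_small_half w (K : R) : loc_weight w -> {ae mu, forall x, 0 < w x} ->
  (forall a l, 0 < l ->
    (mulI (norm_ratio w (hcube a l)) (weight_average w (hcube a l))^-1 <= K%:E)%E) ->
  exists2 alpha, 0 < alpha < 1 & forall a l A, 0 < l -> measurable A ->
    A `<=` hcube a l -> vol A <= alpha * l ^+ n ->
    mass w A <= mass w (hcube a l) / 2.
Proof.
move=> ww wpos hK; have [mw w0 _] := ww.
have [C C0 hC] := truncated_integral n_gt0 r_LH r_ge1 s1 sr mw w0.
pose K' := Num.max K 1; have K'1 : 1 <= K' by rewrite le_max lexx orbT.
have KK' : K <= K' by rewrite le_max lexx.
pose K1 := 2 * K' * C; have K10 : 0 <= K1 by rewrite mulr_ge0//; lra.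
have gt1_s := s1.
(* M is chosen so that M `^ (1 - s) is (4 * K1 + 1)^-1. *)
pose M := (4 * K1 + 1) `^ (s - 1)^-1.
have M1 : 1 <= M by apply: powR_ge1; [lra|rewrite invr_ge0; lra].
have MK : M `^ (1 - s) * K1 <= 4^-1.
  have -> : M `^ (1 - s) = (4 * K1 + 1)^-1.
    rewrite /M -powRrM -(@powR_inv1 _ (4 * K1 + 1)); last lra.
    by congr powR; field; rewrite gt_eqF//; lra.
  by rewrite mulrC ler_pdivrMr; lra.
pose alpha := (8 * K' * M)^-1.
have KM : 8 <= 8 * K' * M.
  have : 8 * 1 <= 8 * K' * M by apply: ler_pM => //; lra.
  lra.
have al0 : 0 < alpha by rewrite invr_gt0; lra.
exists alpha; first by rewrite al0/= invf_lt1; lra.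
move=> a l A l0 mA AQ Al.
have [T [T0 nT hT]] := hC a l l0.
have [nr av hle] := mulI_leP (hK a l l0).
have [n1 n2 nrE] := norm_ratio_fin nr.
have mQ := @measurable_hcube R n a l.
have ln0 : 0 < l ^+ n by exact: exprn_gt0.
have M0 := mass_gt0 a ww wpos l0.
move: hle; rewrite nrE weight_averageE//.
set m := mass _ _ / _; have m0 : 0 < m by rewrite divr_gt0.
have mE : mass w (hcube a l) = m * l ^+ n by rewrite /m divfK// gt_eqF.
rewrite inver gt_eqF// => hle.
have t0 : exists2 t, vLnorm p \1_(hcube a l) = t%:E & 0 < t <= T.
  move: n1 nT (@vLnorm_ge0 R n r \1_(hcube a l)); case: (vLnorm p _) => // t.
  by rewrite eqe !lee_fin => tn0 tT t0; exists t => //; rewrite lt_def tn0 t0.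
have [t tE /andP[t_gt0 tT]] := t0.
have lam : (vLnorm p (fun x => w x * \1_(hcube a l) x)%R < (2 * K' * T * m)%:E)%E.
  move: n2 hle (@vLnorm_ge0 R n r (fun x => w x * \1_(hcube a l) x)%R); rewrite tE inver gt_eqF//.
  case: (vLnorm p _) => // lam _; rewrite -!EFinM !lee_fin lte_fin => h lam0.
  exact: (lt_double_bound t_gt0 tT m0 KK' K'1 h).
have [t' [t'0 t'l wt']] := vLnorm_lt lam.
rewrite lte_fin in t'l.
have := hT t' M A t'0 wt' M1 mA AQ.
rewrite (mass_fin_sub ww l0 mA AQ) lee_fin => h; apply: (le_trans h).
rewrite mE.
exact: (small_portion_bound K'1 T0 m0 ln0 (vol_ge0 A) Al M1 C0 (powR_ge0 _ _) MK (ltW t'l)).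
Qed.

End weight_classes.

(** * Equality of the two classes *)

Section inclusions.
Local Open Scope classical_set_scope.
Local Open Scope ring_scope.
Context {R : realType} {n : nat}.
Local Notation V := (Rn R n).
Local Notation mu := (@lebesgueRn R n).
Implicit Types (a : 'I_n -> R) (l : R) (Q A B D E : set V) (w : V -> R).

Variable r : V -> R.
Hypotheses (n_gt0 : (0 < n)%N) (r_LH : LH r) (r_ge1 : forall x, 1 <= r x).
Variable s : R.
Hypotheses (s1 : 1 < s) (sr : forall x, s <= r x).
Local Notation p := (EFin \o r).

Lemma bounded_cubes w (F : set V -> \bar R) :
  (ereal_sup [set F Q | Q in cube] < +oo)%E ->
  exists K : R, forall a l, 0 < l -> (F (hcube a l) <= K%:E)%E.
Proof.
move=> Foo; have h a l : 0 < l -> (F (hcube a l) <= ereal_sup [set F Q | Q in cube])%E.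
  by move=> l0; apply: ereal_sup_ubound; exists (hcube a l) => //; exact: cube_hcube.
move: Foo h; case: ereal_sup => // [K|] _ h; first by exists K.
by exists 0 => a l l0; exact: le_trans (h a l l0) (leNye _).
Qed.

(** In the two conditions a product with an infinite factor is infinite, so that
    a bound forces the norm of [w] on each cube to be finite. *)
Lemma loc_weight_ratio w : scalar_weight w ->
  (forall a l, 0 < l -> norm_ratio r w (hcube a l) != +oo%E) -> loc_weight w.
Proof.
move=> [mw w0 _] h; apply: (loc_weight_of_norm n_gt0 r_LH r_ge1 s1 sr mw w0).
by move=> a l l0; have [] := norm_ratio_fin (h a l l0).
Qed.

Lemma Ap_oo_sub_star w : Ap_oo p w -> Ap_oo_star p w.
Proof.
move=> [sw]; have [mw w0 wpos] := sw => fin; split=> //.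
have [K hK] := @bounded_cubes w (fun Q => mulI (norm_ratio r w Q) (expeR (log_average w Q))) fin.
have ww : loc_weight w.
  by apply: loc_weight_ratio => // a l l0; have [] := mulI_leP (hK a l l0).
apply: le_lt_trans (ltry K); apply: ge_ereal_sup => _ [Q cQ <-].
have [a [l [l0 h1 _ h3]]] := cube_data r_LH mw w0 cQ.
rewrite -/(norm_ratio r w Q) -/(weight_average w Q) h1 h3.
apply: le_trans (hK a l l0); apply: le_mulI; first exact: norm_ratio_ge0.
exact: weight_average_le.
Qed.

Lemma Ap_oo_star_sub w : Ap_oo_star p w -> Ap_oo p w.
Proof.
move=> [sw]; have [mw w0 wpos] := sw => fin; split=> //.
have [K hK] := @bounded_cubes w (fun Q => mulI (norm_ratio r w Q) (weight_average w Q)^-1%E) fin.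
have ww : loc_weight w.
  by apply: loc_weight_ratio => // a l l0; have [] := mulI_leP (hK a l l0).
have [alpha al01 half] := star_small_half n_gt0 r_LH r_ge1 s1 sr ww wpos hK.
have [C hC] := log_inv_mean ww al01 half (fun a l => mass_gt0 a ww wpos).
apply: le_lt_trans (ltry (K * expR C)); apply: ge_ereal_sup => _ [Q cQ <-].
have [a [l [l0 h1 h2 _]]] := cube_data r_LH mw w0 cQ.
rewrite -/(norm_ratio r w Q) -/(log_average w Q) h1 h2.
have [nr _ hle] := mulI_leP (hK a l l0).
have ln0 : 0 < l ^+ n by exact: exprn_gt0.
have M0 := mass_gt0 a ww wpos l0.
have hlog := hC a l l0.
rewrite (weight_averageE a ww l0) in hle.
pose m := mass w (hcube a l) / l ^+ n; have m0 : 0 < m := divr_gt0 M0 ln0.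
rewrite -/m in hle hlog; rewrite inver (gt_eqF m0) in hle.
have lav : (expeR (log_average w (hcube a l)) <= (expR C / m)%:E)%E.
  have -> : ((expR C / m)%:E = expeR (C - ln m)%:E)%E by rewrite /= expRD expRN lnK.
  rewrite lee_expeR /log_average (averageE _ _ l0).
  rewrite -(expr_scaleK (C - ln m) n l0) EFinM.
  have li : (0 <= (l ^- n)%:E)%E by rewrite lee_fin invr_ge0 ltW.
  exact: (lee_wpmul2l li hlog).
apply: le_trans (le_mulI (norm_ratio_ge0 r w (hcube a l)) lav) _.
have eC : (0 <= (expR C)%:E)%E by rewrite lee_fin expR_ge0.
have fin_e : ((expR C / m)%:E == +oo)%E = false by [].
rewrite /mulI (negbTE nr) fin_e orFb [expR C / m]mulrC !EFinM muleA.
exact: (lee_wpmul2r eC hle).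
Qed.

End inclusions.

Theorem theorem2p13 (R : realType) (n : nat) (p : Rn R n -> \bar R) :
  (0 < n)%N -> var_exponent p -> var_exponent_LH p ->
  (1%:E < ess_inf (@lebesgueRn R n) p)%E ->
  Ap_oo p = Ap_oo_star p.
Proof.
move=> n_gt0 [_ p_ge1] [r r_LH pE] p_gt1; subst p.
have r_ge1 x : (1 <= r x)%R by have := p_ge1 x; rewrite /= lee_fin.
have [s s1 s_inf] : exists2 s : R, (1 < s)%R & (s%:E <= ess_inf (@lebesgueRn R n) (EFin \o r))%E.
  move: p_gt1; case: ess_inf => // [v|_]; last by exists 2%R => //; [lra|exact: leey].
  by rewrite lte_fin => v1; exists v.
have s_r : {ae @lebesgueRn R n, forall x, (s <= r x)%R} by move/ess_infP: s_inf.
have sr := exponent_ge n_gt0 r_LH s_r.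
apply/seteqP; split=> w.
  exact: (Ap_oo_sub_star n_gt0 r_LH r_ge1 s1 sr).
exact: (Ap_oo_star_sub n_gt0 r_LH r_ge1 s1 sr).
Qed.
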